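(* Let $0<\alpha<1$ and let $(S_t)_{t\ge0}$ be an $\alpha$-stable subordinator. If $f:(0,\infty)\to[0,\infty)$ is a measurable function such that $\mathrm{Leb}\{f>0\}>0$, then $$\mathbb{E}\left[\left(\int_0^\infty f(t)\,dS_t\right)^p\right]=\begin{cases}\dfrac{\Gamma\left(1-\frac p\alpha\right)}{\Gamma(1-p)}\left(\int_0^\infty f(t)^\alpha\,dt\right)^{p/\alpha}, & \text{if } -\infty<p<\alpha,\\[2mm] \infty, & \text{if } p\ge\alpha.\end{cases}$$
   Context: An $\alpha$-stable subordinator $(S_t)_{t\ge0}$, $0<\alpha<1$, is an increasing càdlàg Lévy process on $[0,\infty)$ with $S_0=0$ and $\mathbb{E}[e^{-rS_t}]=e^{-tr^\alpha}$ for $r>0$, $t\ge0$ (its Bernstein function is $\phi(r)=r^\alpha$). The integral $\int_0^\infty f(t)\,dS_t\in[0,\infty]$ is the pathwise Lebesgue–Stieltjes integral over $(0,\infty)$. $\mathrm{Leb}$ is Lebesgue measure. Conventions: $\infty^p=\infty$ for $p>0$, $\infty^0=1$, $\infty^p=0$ for $p<0$. *)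

(* Defs.v *)
From HB Require Import structures.
From mathcomp Require Import all_boot all_order all_algebra.
From mathcomp Require Import all_classical all_reals all_analysis.

Set Implicit Arguments.
Unset Strict Implicit.
Unset Printing Implicit Defensive.

Import Order.TTheory GRing.Theory Num.Theory.
Import numFieldNormedType.Exports.

Local Open Scope classical_set_scope.
Local Open Scope ring_scope.

(* Euler's integral; it represents the Gamma function only for 0 < z. *)
Definition Gamma (R : realType) (z : R) : R :=
  \int[@lebesgue_measure R]_(t in `]0, +oo[) (t `^ (z - 1) * expR (- t)).

(* The library power has +oo `^ p = +oo and 0 `^ p = 0 for p < 0; here negative
   powers go through the extended inverse, so that +oo ^ p = 0 and 0 ^ p = +oo
   for p < 0. For 0 <= p the library convention (+oo ^ 0 = 1) is kept. *)
Definition epow (R : realType) (x : \bar R) (p : R) : \bar R :=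
  (if (p < 0)%R then (x `^ (- p)%R)^-1 else x `^ p)%E.

Section paths.
Variable R : realType.

(* Paths are indexed by all of R, but only their restriction to [0, +oo[ is
   ever used. *)
Definition increasing_path (F : R -> R) : Prop :=
  forall s t : R, 0 <= s -> s <= t -> F s <= F t.

Definition cadlag_path (F : R -> R) : Prop :=
  (forall t : R, 0 <= t -> F x @[x --> t^'+] --> F t) /\
  (forall t : R, 0 < t -> cvg (F x @[x --> t^'-])).

(* The extension of a path by the constant F 0 to ]-oo, 0[ *)
Definition path_ext (F : R -> R) : R -> R := fun t => F (Num.max t 0).

Lemma path_ext_nondecreasing F :
  increasing_path F -> nondecreasing (path_ext F).
Proof.
move=> ndF s t st; apply: ndF; first by rewrite le_max lexx orbT.
by rewrite ge_max !le_max st lexx orbT.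
Qed.

Lemma path_ext_right_continuous F :
  cadlag_path F -> right_continuous (path_ext F).
Proof.
move=> [rcF _] t; have [t0|t0] := ltP t 0.
  have Ft : path_ext F t = F 0 by rewrite /path_ext max_r// ltW.
  rewrite Ft; apply: cvg_near_cst.
  near=> x; rewrite /path_ext max_r//.
  by near: x; exact: nbhs_right_le.
rewrite {2}/path_ext max_l//.
apply: cvg_trans (rcF _ t0); apply: near_eq_cvg.
near=> x; rewrite /path_ext max_l//.
by apply: (le_trans t0); near: x; exact: nbhs_right_ge.
Unshelve. all: by end_near.
Qed.

Definition path_cumulative F (ndF : increasing_path F) (cF : cadlag_path F) :
    cumulative R R :=
  HB.pack_for (cumulative R R) (path_ext F)
    (isCumulative.Build R _ R (path_ext F)
      (path_ext_nondecreasing ndF) (path_ext_right_continuous cF)).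

Definition stieltjes_integral F (ndF : increasing_path F) (cF : cadlag_path F)
    (f : R -> R) : \bar R :=
  (\int[lebesgue_stieltjes_measure (path_cumulative ndF cF)]_(t in `]0%R, +oo[)
     (f t)%:E)%E.

End paths.

Section processes.
Context {d : measure_display} {T : measurableType d} {R : realType}.
Variable P : probability T R.

Definition mutually_independent (n : nat) (X : 'I_n -> T -> R) : Prop :=
  forall (A : {set 'I_n}) (B : 'I_n -> set R),
    (forall i, measurable (B i)) ->
    P (\bigcap_(i in [set` A]) (X i @^-1` B i)) =
    (\prod_(i in A) P (X i @^-1` B i))%E.

(* A real process indexed by [0, +oo[; the values S t for t < 0 are junk. *)
Record levy_process (S : R -> T -> R) : Prop := {
  levy_measurable : forall t : R, 0 <= t -> measurable_fun setT (S t) ;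
  levy_start : forall w, S 0 w = 0 ;
  levy_cadlag : forall w, cadlag_path (S^~ w) ;
  levy_independent_increments : forall (n : nat) (t : nat -> R),
    0 <= t 0%N -> {homo t : i j / (i <= j)%N >-> i <= j} ->
    mutually_independent (fun (i : 'I_n) w => S (t i.+1) w - S (t i) w) ;
  levy_stationary_increments : forall (s t : R) (B : set R),
    0 <= s -> s <= t -> measurable B ->
    P ((fun w => S t w - S s w) @^-1` B) =
    P ((fun w => S (t - s) w - S 0 w) @^-1` B)
}.

Record stable_subordinator (alpha : R) (S : R -> T -> R) : Prop := {
  subordinator_levy : levy_process S ;
  subordinator_increasing : forall w, increasing_path (S^~ w) ;
  subordinator_laplace : forall r t : R, 0 < r -> 0 <= t ->
    ('E_P[fun w => expR (- r * S t w)] = (expR (- t * r `^ alpha)%R)%:E)%E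
}.

Definition integral_dS (alpha : R) (S : R -> T -> R)
    (hS : stable_subordinator alpha S) (f : R -> R) (w : T) : \bar R :=
  stieltjes_integral (subordinator_increasing hS w)
    (levy_cadlag (subordinator_levy hS) w) f.

End processes.

(* Main.v *)
Require Import Defs.
From HB Require Import structures.
From mathcomp Require Import all_boot all_order all_algebra.
From mathcomp Require Import all_classical all_reals all_analysis.
From mathcomp Require Import measurable_realfun ring lra.
Set Implicit Arguments.
Unset Strict Implicit.
Unset Printing Implicit Defensive.
Import Order.TTheory GRing.Theory Num.Theory.
Import numFieldNormedType.Exports.
Local Open Scope classical_set_scope.
Local Open Scope ring_scope.

(** Put X = int f dS and C = int f^alpha dt, both in [0, +oo].  Everything about
    the law of X is contained in its Laplace transform
      E exp(- r X) = exp(- r^alpha C)   for r > 0,   with exp(- oo) = 0.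
    For a step function this is the product formula for the independent and
    stationary increments of S.  The set of functions for which it holds is
    closed under bounded pointwise limits, by dominated convergence for the
    path measures, for Lebesgue measure and for P ([laplace_at_limit]).  Steps
    on finer and finer grids converge to bounded continuous functions, and
    bounded Borel functions are obtained from bounded continuous ones by
    iterating bounded limits ([bounded_measurable_baire]).  Truncating height
    and support at n and letting n grow gives every measurable f >= 0
    ([laplace_functional]).

    The moments are then read off the transform.  For x in [0, +oo],
      int_0^oo q r^(q-1) exp(- x r^b) dr = Gamma(1 + q/b) x^(-q/b)  (q, b > 0),
      int_0^oo p r^(-p-1) (1 - exp(- x r^b)) dr = Gamma(1 - p/b) x^(p/b)
                                                              (0 < p < b)
    ([mellin_expeR], [mellin_one_sub_expeR]).  With b = 1 and x = X these
    formulas represent Gamma(1 - p) X^p by the exponentials exp(- r X).  Taking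
    expectations under the integral replaces exp(- r X) by exp(- r^alpha C),
    which is the case b = alpha and x = C of the same formulas; hence
      Gamma(1 - p) E X^p = Gamma(1 - p/alpha) C^(p/alpha)
    for p < 0 and for 0 < p < alpha ([moment_neg], [moment_pos]).  As q
    increases to alpha, Gamma(1 - q/alpha) tends to +oo while Gamma(1 - q)
    stays bounded; since X^q <= 1 + X^p for 0 < q < alpha <= p, the moments of
    order p >= alpha are infinite when C > 0 ([moment_infty]). *)

(** * Exchanging integrals over a region *)

(** Tonelli's theorem for the density g(x) h(y) on the region b x y.  The
    layer-cake arguments below are instances: one of the two inner integrals is
    an explicit primitive, the other one the object of interest. *)
Lemma tonelli_relation (d1 d2 : measure_display) (X : measurableType d1)
    (Y : measurableType d2) (R : realType)
    (m1 : {sigma_finite_measure set X -> \bar R})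
    (m2 : {sigma_finite_measure set Y -> \bar R})
    (D : set X) (E : set Y) (g : X -> R) (h : Y -> R) (b : X -> Y -> bool) :
  measurable D -> measurable E ->
  measurable_fun setT g -> measurable_fun setT h ->
  measurable_fun setT (fun z : X * Y => b z.1 z.2) ->
  (forall x, 0 <= g x) -> (forall y, 0 <= h y) ->
  (\int[m1]_(x in D) ((g x)%:E * \int[m2]_(y in E `&` [set y | b x y]) (h y)%:E)
   = \int[m2]_(y in E) ((h y)%:E * \int[m1]_(x in D `&` [set x | b x y]) (g x)%:E))%E.
Proof.
move=> mD mE mg mh mb g0 h0.
pose f (z : X * Y) : \bar R :=
  (g z.1 * h z.2 * \1_D z.1 * \1_E z.2 * (if b z.1 z.2 then 1 else 0))%:E.
have mf : measurable_fun [set: (X * Y)%type] f.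
  apply/measurable_EFinP; apply: measurable_funM; last exact: measurable_fun_ifT.
  do !apply: measurable_funM; by [
    exact: (measurableT_comp mg)|exact: (measurableT_comp mh)|
    apply: (measurableT_comp (measurable_indic mD))|
    apply: (measurableT_comp (measurable_indic mE))].
have f0 z : (0 <= f z)%E.
  rewrite lee_fin !mulr_ge0//; by case: ifP.
have mbx x : measurable [set y | b x y].
  have := mb measurableT [set true] Logic.I.
  rewrite setTI => /(measurable_xsection x); congr measurable.
  by apply/seteqP; split => y; rewrite /xsection/= inE/=.
have mby y : measurable [set x | b x y].
  have := mb measurableT [set true] Logic.I.
  rewrite setTI => /(measurable_ysection y); congr measurable.
  by apply/seteqP; split => x; rewrite /ysection/= inE/=.
transitivity (\int[m1]_x \int[m2]_y f (x, y))%E; last first.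
  rewrite fubini_tonelli// [RHS]integral_mkcond; apply: eq_integral => y _.
  rewrite patchE; case: ifPn => [yE|yE]; last first.
    rewrite integral0_eq// => x _; rewrite /f/= [\1_E y]indicE (negbTE yE).
    by rewrite mulr0 mul0r.
  rewrite -ge0_integralZl_EFin; last 4 first.
  - exact: measurableI.
  - by move=> ? _; rewrite lee_fin.
  - by apply: measurable_funTS; exact/measurable_EFinP.
  - by [].
  rewrite [RHS]integral_mkcond; apply: eq_integral => x _.
  rewrite /f/= !indicE yE patchE in_setI.
  case: (boolP (x \in D)) => xD /=; last by rewrite mulr0 !mul0r.
  case: (boolP (b x y)) => bxy.
    by rewrite mem_set//= !mulr1 -EFinM mulrC.
  by rewrite mulr0 memNset//; exact/negP.
rewrite integral_mkcond; apply: eq_integral => x _.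
rewrite patchE; case: ifPn => [xD|xD]; last first.
  rewrite integral0_eq// => y _; rewrite /f/= [\1_D x]indicE (negbTE xD).
  by rewrite mulr0 !mul0r.
rewrite -ge0_integralZl_EFin; last 4 first.
- exact: measurableI.
- by move=> ? _; rewrite lee_fin.
- by apply: measurable_funTS; exact/measurable_EFinP.
- by [].
rewrite integral_mkcond; apply: eq_integral => y _.
rewrite /f/= !indicE xD patchE in_setI.
case: (boolP (y \in E)) => yE /=; last by rewrite mulr0 !mul0r.
case: (boolP (b x y)) => bxy.
  by rewrite mem_set//= !mulr1 -EFinM.
by rewrite mulr0 memNset//; exact/negP.
Qed.

(** * Integrals of powers and exponentials *)

Section primitives.
Context {R : realType}.
Local Notation mu := (@lebesgue_measure R).

Lemma powR_continuous_at (a x : R) :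
  0 < x -> {for x, continuous (fun y : R => y `^ a)}.
Proof.
move=> x0; apply: differentiable_continuous; apply/derivable1_diffP.
by apply: derivable_powR; rewrite in_itv/= x0.
Qed.

Lemma measurable_scaled_powR (c a : R) :
  measurable_fun setT (fun r : R => c * r `^ a).
Proof. by apply: measurable_funM => //; exact: measurable_powR. Qed.

Lemma measurable_scaled_expR (x : R) :
  measurable_fun setT (fun s : R => x * expR (- (x * s))).
Proof.
apply: measurable_funM => //; apply: (measurableT_comp (@measurable_expR R)).
by apply: (measurableT_comp (@oppr_measurable R setT)); exact: mulrl_measurable.
Qed.

Lemma integral_powR_tail (p s : R) : 0 < p -> 0 < s ->
  (\int[mu]_(t in `[s, +oo[) (p * t `^ (- p - 1))%:E = (s `^ (- p))%:E)%E.
Proof.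
move=> p0 s0.
have dF (x : R) : s < x -> is_derive x 1 (fun x => - x `^ (- p)) (p * x `^ (- p - 1)).
  move=> sx; have := is_derive1_powR (- p) (lt_trans s0 sx) => dx.
  by apply: is_derive_eq; rewrite mulNr opprK.
have cG := @powR_continuous_at.
rewrite (@ge0_continuous_FTC2y _ _ (fun x => - x `^ (- p)) _ 0)//.
- by rewrite EFinN oppeK add0e.
- by move=> x sx; rewrite mulr_ge0 ?powR_ge0// ltW.
- apply/continuous_within_itvcyP; split => [x|].
    rewrite in_itv/= andbT => sx; apply: (cvgM (cvg_cst _)).
    by apply: cG; exact: lt_trans sx.
  apply: cvgM; first exact: cvg_cst.
  by apply: cvg_at_right_filter; apply: cG.
- rewrite -oppr0; apply: cvgN.
  apply/cvgrPdist_lt => e e0; near=> x.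
  have x0 : 0 < x by near: x; exact: nbhs_pinfty_gt.
  have xe : e^-1 `^ p^-1 < x by near: x; apply: nbhs_pinfty_gt; exact: num_real.
  rewrite sub0r normrN ger0_norm ?powR_ge0// powRN -[e]invrK.
  rewrite ltf_pV2 ?posrE ?invr_gt0 ?powR_gt0//.
  rewrite -[ltLHS](@powRr1 _ e^-1) ?invr_ge0 ?ltW// -(@divff _ p) ?gt_eqF//.
  rewrite mulrC powRrM gt0_ltr_powR ?nnegrE ?powR_ge0//; exact: ltW.
- by move=> x sx; exact: (@ex_derive _ _ _ _ _ _ _ (dF _ sx)).
- by apply: cvgN; apply: cvg_at_right_filter; apply: cG.
- move=> x; rewrite in_itv/= andbT => sx; rewrite derive1E.
  exact: (@derive_val _ _ _ _ _ _ _ (dF _ sx)).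
Unshelve. all: end_near. Qed.

(** For q < 1 the integrand blows up at 0, so the fundamental theorem of calculus
    is applied on [s / (n + 2), s] and the left end point tends to 0. *)
Lemma integral_powR_head (q s : R) : 0 < q -> 0 < s ->
  (\int[mu]_(t in `]0%R, s]) (q * t `^ (q - 1))%:E = (s `^ q)%:E)%E.
Proof.
move=> q0 s0.
have cG := @powR_continuous_at.
(* n + 2 keeps the left end strictly below s, even for n = 0 *)
pose F n : set R := `[s / n.+2%:R, s]%classic.
have F0 n : 0 < s / n.+2%:R by rewrite divr_gt0.
have Fs n : s / n.+2%:R < s by rewrite ltr_pdivrMr// ltr_pMr// ltr1n.
have UF : `]0, s]%classic = \bigcup_n F n.
  apply/seteqP; split => [x|x [n _]]; last first.
    rewrite /F/= !in_itv/= => /andP[nx ->]; rewrite andbT.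
    exact: lt_le_trans nx.
  rewrite /= in_itv/= => /andP[x0 xs].
  have [n] := ltr_add_invr (divr_gt0 x0 s0); rewrite add0r => nx.
  exists n => //; rewrite /F/= in_itv/= xs andbT ltW//.
  rewrite mulrC -ltr_pdivlMr//; apply: le_lt_trans nx.
  by rewrite lef_pV2 ?posrE// ler_nat.
have mf : measurable_fun setT (fun t : R => (q * t `^ (q - 1))%:E).
  by apply/measurable_EFinP; apply: measurable_funM => //; exact: measurable_powR.
have ndF : nondecreasing_seq F.
  move=> m n mn; rewrite subsetEset; apply: subset_itvr; rewrite bnd_simp.
  by rewrite ler_pM2l// lef_pV2 ?posrE// ler_nat !ltnS.
have : (\int[mu]_(t in F n) (q * t `^ (q - 1))%:E @[n --> \oo] -->
    \int[mu]_(t in `]0%R, s]) (q * t `^ (q - 1))%:E)%E.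
  rewrite UF; apply: ge0_nondecreasing_set_cvg_integral => //.
  - by move=> n; exact: measurable_itv.
  - by move=> n; exact: measurable_funTS.
  - by move=> n x _; rewrite lee_fin mulr_ge0 ?powR_ge0// ltW.
move=> /cvg_lim <-//.
have -> : (fun n => \int[mu]_(t in F n) (q * t `^ (q - 1))%:E)%E =
          (fun n => (s `^ q)%:E - ((s / n.+2%:R) `^ q)%:E)%E.
  apply/funext => n.
  have dF (x : R) : 0 < x -> is_derive x 1 (fun x => x `^ q) (q * x `^ (q - 1)).
    by move=> x0; exact: is_derive1_powR.
  rewrite (@continuous_FTC2 _ _ (fun x => x `^ q))//.
  - apply: continuous_in_subspaceT => x; rewrite inE/= in_itv/= => /andP[sx _].
    by apply: (cvgM (cvg_cst _)); apply: cG; exact: lt_le_trans sx.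
  - split => [x||].
    + rewrite in_itv/= => /andP[sx _].
      exact: (@ex_derive _ _ _ _ _ _ _ (dF _ (lt_trans (F0 n) sx))).
    + by apply: cvg_at_right_filter; exact: cG.
    + by apply: cvg_at_left_filter; exact: cG.
  - move=> x; rewrite in_itv/= => /andP[sx _]; rewrite derive1E.
    exact: (@derive_val _ _ _ _ _ _ _ (dF _ (lt_trans (F0 n) sx))).
apply/cvg_lim => //; rewrite -[X in _ --> X]sube0.
apply: cvgeB => //; first exact: cvg_cst.
apply: cvg_EFin; first exact: nearW.
have /cvg_at_rightP := powR_cvg0 q0; apply; split; first exact: F0.
rewrite -[X in _ --> X](mulr0 s); apply: cvgM; first exact: cvg_cst.
by have := @cvg_harmonic R; rewrite -cvg_shiftS.
Qed.

(** Lebesgue measure is x times its image under multiplication by x, because both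
    measures agree on half-open intervals. *)
Lemma ge0_integral_scaling (x : R) (G : R -> R) : 0 < x ->
  measurable_fun setT G -> (forall u, 0 <= G u) ->
  (\int[mu]_(u in `]0%R, +oo[) (G u)%:E =
   \int[mu]_(s in `]0%R, +oo[) (x * G (x * s))%:E)%E.
Proof.
move=> x0 mG G0.
have mphi : measurable_fun [set: measurableTypeR R] ( *%R x : R -> measurableTypeR R).
  exact: mulrl_measurable.
pose m_ := mscale (NngNum (ltW x0)) (pushforward mu ( *%R x : _ -> measurableTypeR R)).
pose m : {measure set (measurableTypeR R) -> \bar R} := m_ mphi.
have mE A : measurable A -> mu A = m A.
  apply: lebesgue_measure_unique => _ [[a b]] _ <-.
  rewrite /m/m_/= /mscale/= /pushforward.
  rewrite (_ : _ @^-1` _ = `]a / x, b / x]%classic); last first.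
    apply/seteqP; split => y /=; rewrite !in_itv/= ltr_pdivrMr// ler_pdivlMr//;
      by rewrite mulrC.
  rewrite !lebesgue_measure_itv/= !lte_fin ltr_pM2r ?invr_gt0//.
  case: ifP => _; last by rewrite mule0.
  by rewrite -!EFinB -EFinM -mulrBl mulrCA divff ?gt_eqF// mulr1.
transitivity (\int[m]_(u in `]0%R, +oo[) (G u)%:E)%E.
  by apply: eq_measure_integral => A mA _; exact: mE.
rewrite ge0_integral_mscale//; last 2 first.
- by apply: measurable_funTS; exact/measurable_EFinP.
- by move=> u _; rewrite lee_fin.
rewrite ge0_integral_pushforward//; last 2 first.
- by apply: measurable_funTS; exact/measurable_EFinP.
- by move=> u _; rewrite lee_fin.
rewrite (_ : _ @^-1` _ = `]0, +oo[%classic); last first.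
  by apply/seteqP; split => y /=; rewrite !in_itv/= !andbT pmulr_rgt0.
rewrite -ge0_integralZl_EFin//; last first.
  by apply: measurable_funTS; apply/measurable_EFinP; exact: measurableT_comp.
by move=> u _; rewrite lee_fin.
Qed.

Lemma is_derive_oppr_expR (x s : R) :
  is_derive s 1 (fun s => - expR (- (x * s))) (x * expR (- (x * s))).
Proof.
have dl : is_derive s (1 : R) ((- x) \*: (@id R)) ((- x) *: 1).
  by apply: is_deriveZ; exact: is_derive_id.
have de := is_deriveN (is_derive1_comp (is_derive_expR _) dl).
have -> : (fun s => - expR (- (x * s))) = - (expR \o ((- x) \*: (@id R))).
  by apply/funext => u /=; congr (- expR _); rewrite -mulNr.
suff <- : - (expR (((- x) \*: (@id R)) s) * ((- x) *: 1)) = x * expR (- (x * s)) by [].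
rewrite [X in - X](_ : _ = expR (- x * s) * (- x * 1))//.
by rewrite mulr1 mulrN opprK mulrC mulNr.
Qed.

Lemma continuous_expR_scale (x : R) : continuous (fun s => expR (- (x * s))).
Proof.
move=> s; apply: continuous_comp; last exact: continuous_expR.
exact: (cvgN (cvgM (cvg_cst x) cvg_id)).
Qed.

Lemma integral_expR_tail (x a : R) : 0 < x ->
  (\int[mu]_(s in `[a, +oo[) (x * expR (- (x * s)))%:E = (expR (- (x * a)))%:E)%E.
Proof.
move=> x0.
have dF := is_derive_oppr_expR x; have cG := @continuous_expR_scale x.
rewrite (@ge0_continuous_FTC2y _ _ (fun s => - expR (- (x * s))) _ 0)//.
- by rewrite EFinN oppeK add0e.
- by move=> s _; rewrite mulr_ge0 ?expR_ge0// ltW.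
- apply: continuous_subspaceT => s.
  by apply: (cvgM (cvg_cst _)); exact: cG.
- rewrite -oppr0; apply: cvgN.
  apply: (@cvg_comp _ _ _ (fun s => x * s) (fun z => expR (- z)) _ (pinfty_nbhs R));
    last exact: cvgr_expR.
  exact: gt0_cvgMry.
- by apply: cvgN; apply: cvg_at_right_filter; apply: cG.
- by move=> s _; rewrite derive1E; exact: (@derive_val _ _ _ _ _ _ _ (dF _)).
Qed.

Lemma integral_expR_head (x a : R) : 0 < x -> 0 < a ->
  (\int[mu]_(s in `]0%R, a]) (x * expR (- (x * s)))%:E = (1 - expR (- (x * a)))%:E)%E.
Proof.
move=> x0 a0.
have dF := is_derive_oppr_expR x; have cG := @continuous_expR_scale x.
rewrite integral_itv_obnd_cbnd; last first.
  apply: measurable_funTS; apply/measurable_EFinP; apply: measurable_funM => //.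
  by apply: measurableT_comp => //; apply: measurableT_comp => //; exact: mulrl_measurable.
rewrite (@continuous_FTC2 _ _ (fun s => - expR (- (x * s))))//.
- by rewrite mulr0 oppr0 expR0 -EFinB; congr EFin; ring.
- apply: continuous_subspaceT => s.
  by apply: (cvgM (cvg_cst _)); exact: cG.
- split => [s _||].
  + exact: (@ex_derive _ _ _ _ _ _ _ (dF _)).
  + by apply: cvgN; apply: cvg_at_right_filter; apply: cG.
  + by apply: cvgN; apply: cvg_at_left_filter; apply: cG.
- by move=> s _; rewrite derive1E; exact: (@derive_val _ _ _ _ _ _ _ (dF _)).
Qed.

(** Euler's integral with values in [0, +oo], so that identities between such
    integrals can be proved before the convergence of any of them. *)
Definition egamma (z : R) : \bar R :=
  (\int[mu]_(t in `]0%R, +oo[) (t `^ (z - 1) * expR (- t))%:E)%E.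

(** The substitution u = x s. *)
Lemma integral_powR_expR (x a : R) : 0 < x ->
  (\int[mu]_(s in `]0%R, +oo[) (x * expR (- (x * s)) * s `^ a)%:E =
   egamma (1 + a) * (x `^ (- a))%:E)%E.
Proof.
move=> x0; rewrite /egamma.
rewrite (@ge0_integral_scaling x (fun t => t `^ (1 + a - 1) * expR (- t)))//; last 2 first.
- apply: measurable_funM; first exact: measurable_powR.
  exact: (measurableT_comp (@measurable_expR R) (@oppr_measurable R setT)).
- by move=> u; rewrite mulr_ge0 ?powR_ge0 ?expR_ge0.
have mx : measurable_fun setT ( *%R x) by exact: mulrl_measurable.
rewrite muleC -ge0_integralZl_EFin ?powR_ge0//; last 2 first.
- by move=> s _; rewrite lee_fin !mulr_ge0 ?powR_ge0 ?expR_ge0 ?ltW.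
- apply: measurable_funTS; apply/measurable_EFinP; apply: measurable_funM => //.
  apply: measurable_funM; first exact: (measurableT_comp (measurable_powR _) mx).
  apply: (measurableT_comp (@measurable_expR R)).
  exact: (measurableT_comp (@oppr_measurable R setT) mx).
apply: eq_integral => s; rewrite inE/= in_itv/= andbT => s0.
rewrite -EFinM; congr EFin; rewrite (addrC 1) addrK powRM ?ltW// powRN.
by field; rewrite gt_eqF// powR_gt0.
Qed.
End primitives.

(** * Mellin transforms of exponentials and the Gamma function *)

Section mellin.
Context {R : realType}.
Local Notation mu := (@lebesgue_measure R).

Let powRK (b r : R) : 0 < b -> 0 < r -> (r `^ b) `^ b^-1 = r.
Proof. by move=> b0 r0; rewrite -powRrM divff ?gt_eqF// powRr1// ltW. Qed.

Let powRVK (b r : R) : 0 < b -> 0 < r -> (r `^ b^-1) `^ b = r.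
Proof. by move=> b0 r0; rewrite -powRrM mulVf ?gt_eqF// powRr1// ltW. Qed.

Let ler_powR2 (b r s : R) : 0 < b -> 0 < r -> r <= s -> r `^ b <= s `^ b.
Proof.
move=> b0 r0 rs; apply: ge0_ler_powR => //; rewrite ?nnegrE; first exact: ltW.
  exact: ltW.
exact: le_trans (ltW r0) rs.
Qed.

Lemma powR_le_root (b r s : R) : 0 < b -> 0 < r -> 0 < s ->
  (r `^ b <= s) = (r <= s `^ b^-1).
Proof.
move=> b0 r0 s0; apply/idP/idP => h.
  by rewrite -(powRK b0 r0) ler_powR2 ?invr_gt0 ?powR_gt0.
by rewrite -(powRVK b0 s0) ler_powR2.
Qed.

Lemma powR_ge_root (b r s : R) : 0 < b -> 0 < r -> 0 < s ->
  (s <= r `^ b) = (s `^ b^-1 <= r).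
Proof.
move=> b0 r0 s0; apply/idP/idP => h.
  by rewrite -(powRK b0 r0) ler_powR2 ?invr_gt0.
by rewrite -(powRVK b0 s0) ler_powR2 ?powR_gt0.
Qed.

(** Write exp(- x r^b) as the integral of x exp(- x s) over s >= r^b and exchange
    the integrals: for fixed s, r runs over ]0, s^(1/b)], where q r^(q-1) has
    integral s^(q/b).  What remains is a Gamma integral. *)
Lemma mellin_expR_pos (b q x : R) : 0 < b -> 0 < q -> 0 < x ->
  (\int[mu]_(r in `]0%R, +oo[) (q * r `^ (q - 1) * expR (- (x * r `^ b)))%:E =
   egamma (1 + q / b) * (x `^ (- (q / b)))%:E)%E.
Proof.
move=> b0 q0 x0; rewrite -integral_powR_expR//.
have mb : measurable_fun [set: R * R] (fun z : R * R => z.1 `^ b <= z.2).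
  apply: measurable_fun_ler => //; apply: (measurableT_comp (measurable_powR b)).
  exact: measurable_fst.
have g0 r : 0 <= q * r `^ (q - 1) by rewrite mulr_ge0 ?powR_ge0// ltW.
have h0 s : 0 <= x * expR (- (x * s)) by rewrite mulr_ge0 ?expR_ge0// ltW.
have H := @tonelli_relation _ _ _ _ _ mu mu _ _ _ _ (fun r s : R => r `^ b <= s)
  (measurable_itv `]0, +oo[) (measurable_itv `]0, +oo[)
  (measurable_scaled_powR q (q - 1)) (measurable_scaled_expR x) mb g0 h0.
transitivity (\int[mu]_(r in `]0%R, +oo[) ((q * r `^ (q - 1))%:E *
    \int[mu]_(s in `]0%R, +oo[ `&` [set s | (r `^ b <= s)%R]) (x * expR (- (x * s)))%:E))%E.
  apply: eq_integral => r; rewrite inE/= in_itv/= andbT => r0.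
  rewrite (_ : _ `&` _ = `[r `^ b, +oo[%classic) ?integral_expR_tail// ?EFinM//.
  apply/seteqP; split => s /=; rewrite !in_itv/= !andbT; first by case.
  by move=> rs; split=> //; apply: lt_le_trans rs; rewrite powR_gt0.
rewrite H; apply: eq_integral => s; rewrite inE/= in_itv/= andbT => s0.
rewrite (_ : _ `&` _ = `]0, s `^ b^-1]%classic); last first.
  apply/seteqP; split => r /=; rewrite !in_itv/= andbT.
    by case=> r0; rewrite r0 powR_le_root.
  by case/andP => r0; rewrite powR_le_root.
by rewrite integral_powR_head ?powR_gt0// -EFinM -powRrM (mulrC b^-1).
Qed.

(** The same exchange on the complementary region s <= r^b, over which
    x exp(- x s) has integral 1 - exp(- x r^b); for fixed s, r now runs over
    [s^(1/b), +oo[. *)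
Lemma mellin_one_sub_expR_pos (b p x : R) : 0 < b -> 0 < p -> 0 < x ->
  (\int[mu]_(r in `]0%R, +oo[) (p * r `^ (- p - 1) * (1 - expR (- (x * r `^ b))))%:E =
   egamma (1 - p / b) * (x `^ (p / b))%:E)%E.
Proof.
move=> b0 p0 x0; rewrite -{2}(opprK (p / b)) -integral_powR_expR//.
have mb : measurable_fun [set: R * R] (fun z : R * R => z.2 <= z.1 `^ b).
  apply: measurable_fun_ler => //; apply: (measurableT_comp (measurable_powR b)).
  exact: measurable_fst.
have g0 r : 0 <= p * r `^ (- p - 1) by rewrite mulr_ge0 ?powR_ge0// ltW.
have h0 s : 0 <= x * expR (- (x * s)) by rewrite mulr_ge0 ?expR_ge0// ltW.
have H := @tonelli_relation _ _ _ _ _ mu mu _ _ _ _ (fun r s : R => s <= r `^ b)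
  (measurable_itv `]0, +oo[) (measurable_itv `]0, +oo[)
  (measurable_scaled_powR p (- p - 1)) (measurable_scaled_expR x) mb g0 h0.
transitivity (\int[mu]_(r in `]0%R, +oo[) ((p * r `^ (- p - 1))%:E *
    \int[mu]_(s in `]0%R, +oo[ `&` [set s | (s <= r `^ b)%R]) (x * expR (- (x * s)))%:E))%E.
  apply: eq_integral => r; rewrite inE/= in_itv/= andbT => r0.
  rewrite (_ : _ `&` _ = `]0, r `^ b]%classic) ?integral_expR_head ?powR_gt0//.
  apply/seteqP; split => s /=; rewrite !in_itv/= !andbT; first by case=> -> ->.
  by case/andP.
rewrite H; apply: eq_integral => s; rewrite inE/= in_itv/= andbT => s0.
rewrite (_ : _ `&` _ = `[s `^ b^-1, +oo[%classic); last first.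
  apply/seteqP; split => r /=; rewrite !in_itv/= !andbT.
    by case=> r0; rewrite powR_ge_root.
  move=> sr; have r0 : 0 < r by apply: lt_le_trans sr; rewrite powR_gt0.
  by rewrite powR_ge_root.
by rewrite integral_powR_tail ?powR_gt0// -EFinM -powRrM (mulrC b^-1) mulNr.
Qed.

Let mgamma (z : R) : measurable_fun setT (fun t : R => (t `^ (z - 1) * expR (- t))%:E).
Proof.
apply/measurable_EFinP; apply: measurable_funM; first exact: measurable_powR.
exact: (measurableT_comp (@measurable_expR R) (@oppr_measurable R setT)).
Qed.

(** The functional equation is the Mellin transform at b = x = 1. *)
Lemma egammaD1 (q : R) : 0 < q -> (egamma (1 + q) = q%:E * egamma q)%E.
Proof.
move=> q0; have := @mellin_expR_pos 1 q 1 ltr01 q0 ltr01.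
rewrite divr1 powR1 mule1 => <-; rewrite /egamma -ge0_integralZl_EFin ?ltW//.
- apply: eq_integral => r; rewrite inE/= in_itv/= andbT => r0.
  by rewrite mul1r powRr1 ?ltW// -EFinM mulrA.
- by move=> r _; rewrite lee_fin mulr_ge0 ?powR_ge0 ?expR_ge0.
- exact: (measurable_funTS (mgamma q)).
Qed.

Lemma integral_powR01 (z : R) : 0 < z ->
  (\int[mu]_(t in `]0%R, 1%R]) (t `^ (z - 1))%:E = (z^-1)%:E)%E.
Proof.
move=> z0; have := @integral_powR_head R z 1 z0 ltr01.
under eq_integral do rewrite EFinM.
rewrite powR1 ge0_integralZl_EFin ?ltW//.
- case: (\int[mu]_(t in _) _)%E => [r| |].
  + rewrite -EFinM => -[] /(canRL (mulKf (lt0r_neq0 z0))); by rewrite mulr1 => ->.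
  + by rewrite gt0_muley ?lte_fin.
  + by rewrite gt0_muleNy ?lte_fin.
- by move=> r _; rewrite lee_fin powR_ge0.
- by apply: measurable_funTS; apply/measurable_EFinP; exact: measurable_powR.
Qed.

(** On ]0, 1] the exponential is at least exp(-1).  The pole at 0 is what makes the
    moments of order close to alpha large. *)
Lemma egamma_ge (z : R) : 0 < z -> ((expR (-1) / z)%:E <= egamma z)%E.
Proof.
move=> z0; apply: (@le_trans _ _
    (\int[mu]_(t in `]0%R, 1%R]) (t `^ (z - 1) * expR (- t))%:E)%E).
  rewrite EFinM -integral_powR01// -ge0_integralZl_EFin ?expR_ge0//; last 2 first.
  - by move=> r _; rewrite lee_fin powR_ge0.
  - by apply: measurable_funTS; apply/measurable_EFinP; exact: measurable_powR.
  apply: ge0_le_integral => //.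
  - by move=> t _; rewrite -EFinM lee_fin mulr_ge0 ?powR_ge0 ?expR_ge0.
  - apply: measurable_funTS; apply: measurable_funeM.
    by apply/measurable_EFinP; exact: measurable_powR.
  - exact: (measurable_funTS (mgamma z)).
  - move=> t /=; rewrite in_itv/= => /andP[_ t1].
    by rewrite -EFinM lee_fin mulrC ler_wpM2l ?powR_ge0// ler_expR lerN2.
apply: ge0_subset_integral => //.
- exact: (measurable_funTS (mgamma z)).
- by move=> t _; rewrite lee_fin mulr_ge0 ?powR_ge0 ?expR_ge0.
- by apply: subset_itvl.
Qed.

Lemma egamma_gt0 (z : R) : 0 < z -> (0 < egamma z)%E.
Proof.
move=> z0; apply: lt_le_trans (egamma_ge z0).
by rewrite lte_fin divr_gt0 ?expR_gt0.
Qed.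

Lemma egamma_le (z : R) : 0 < z -> z <= 1 -> (egamma z <= (z^-1 + 1)%:E)%E.
Proof.
move=> z0 z1; rewrite /egamma.
have -> : `]0%R, +oo[%classic = `]0%R, 1%R] `|` `]1%R, +oo[ :> set R.
  by apply: itv_bndbnd_setU; rewrite bnd_simp.
rewrite ge0_integral_setU//=; last 3 first.
- exact: (measurable_funTS (mgamma z)).
- by move=> t _; rewrite lee_fin mulr_ge0 ?powR_ge0 ?expR_ge0.
- apply/disj_setPS => t [] /=; rewrite !in_itv/= andbT => /andP[_ t1] t1'.
  by move: (le_lt_trans t1 t1'); rewrite ltxx.
rewrite EFinD; apply: leeD.
  rewrite -integral_powR01//; apply: ge0_le_integral => //.
  - by move=> t _; rewrite lee_fin mulr_ge0 ?powR_ge0 ?expR_ge0.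
  - exact: (measurable_funTS (mgamma z)).
  - by apply: measurable_funTS; apply/measurable_EFinP; exact: measurable_powR.
  - move=> t /=; rewrite in_itv/= => /andP[t0 _].
    by rewrite lee_fin ler_piMr ?powR_ge0// expR_le1 oppr_le0 ltW.
apply: (@le_trans _ _ (\int[mu]_(t in `[1%R, +oo[) (1 * expR (- (1 * t)))%:E)%E).
  rewrite -integral_itv_obnd_cbnd; last first.
    by apply: measurable_funTS; apply/measurable_EFinP; exact: measurable_scaled_expR.
  apply: ge0_le_integral => //.
  - by move=> t _; rewrite lee_fin mulr_ge0 ?powR_ge0 ?expR_ge0.
  - exact: (measurable_funTS (mgamma z)).
  - by apply: measurable_funTS; apply/measurable_EFinP; exact: measurable_scaled_expR.
  - move=> t /=; rewrite in_itv/= andbT => t1.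
    rewrite !mul1r lee_fin ler_piMl ?expR_ge0//.
    by rewrite -[leRHS](powRr0 t) ler_powR ?subr_le0 // ltW.
by rewrite integral_expR_tail// lee_fin expR_le1 oppr_le0 mul1r.
Qed.

(** Up to z = 1 the explicit bound applies; the functional equation then reaches
    every z, one unit at a time. *)
Lemma egamma_fin_num (z : R) : 0 < z -> egamma z \is a fin_num.
Proof.
move=> z0; suff : forall n (w : R), 0 < w -> w <= n.+1%:R -> (egamma w < +oo)%E.
  move=> /(_ (Num.trunc z) z z0); rewrite ge0_fin_numE; last by apply/ltW/egamma_gt0.
  by apply; apply/ltW/truncnS_gt.
elim=> [|n ih] w w0 wn; first by apply: le_lt_trans (egamma_le w0 wn) _; rewrite ltry.
have [w1|w1] := leP w 1; first by apply: le_lt_trans (egamma_le w0 w1) _; rewrite ltry.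
have w10 : 0 < w - 1 by rewrite subr_gt0.
rewrite -(subrKC 1 w) egammaD1// lte_mul_pinfty ?lee_fin ?ltW// ih//.
by rewrite lerBlDr natr1.
Qed.

Lemma GammaE (z : R) : 0 < z -> (Gamma z)%:E = egamma z.
Proof. by move=> z0; rewrite /Gamma /Rintegral fineK// egamma_fin_num. Qed.

(** The primitive r^q is unbounded at +oo.  This is the Mellin transform of the
    exponential at x = 0. *)
Lemma integral_powR_head_infty (q : R) : 0 < q ->
  (\int[mu]_(r in `]0%R, +oo[) (q * r `^ (q - 1))%:E = +oo)%E.
Proof.
move=> q0; apply/eqyP => M M0.
have s0 : 0 < M `^ q^-1 by rewrite powR_gt0.
have := integral_powR_head q0 s0.
rewrite -powRrM (mulVf (lt0r_neq0 q0)) (powRr1 (ltW M0)) => <-.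
apply: ge0_subset_integral => //.
- apply: measurable_funTS; apply/measurable_EFinP; exact: measurable_scaled_powR.
- by move=> r _; rewrite lee_fin mulr_ge0 ?powR_ge0// ltW.
- by apply: subset_itvl.
Qed.

(** The primitive - r^(-p) is unbounded at 0.  This is the Mellin transform of
    1 - exp at x = +oo. *)
Lemma integral_powR_tail_infty (p : R) : 0 < p ->
  (\int[mu]_(r in `]0%R, +oo[) (p * r `^ (- p - 1))%:E = +oo)%E.
Proof.
move=> p0; apply/eqyP => M M0.
have s0 : 0 < M `^ (- p^-1) by rewrite powR_gt0.
have := integral_powR_tail p0 s0.
rewrite -powRrM mulrNN (mulVf (lt0r_neq0 p0)) (powRr1 (ltW M0)) => <-.
apply: ge0_subset_integral => //.
- apply: measurable_funTS; apply/measurable_EFinP; exact: measurable_scaled_powR.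
- by move=> r _; rewrite lee_fin mulr_ge0 ?powR_ge0// ltW.
- by apply: subset_itvr; rewrite bnd_simp.
Qed.

(** Adding the end points x = 0 and x = +oo, where the integral is +oo and 0. *)
Lemma mellin_expeR (b q : R) (x : \bar R) : 0 < b -> 0 < q -> (0 <= x)%E ->
  (\int[mu]_(r in `]0%R, +oo[)
     ((q * r `^ (q - 1))%:E * expeR (- (x * (r `^ b)%:E))) =
   egamma (1 + q / b) * epow x (- (q / b)))%E.
Proof.
move=> b0 q0; have qb0 : 0 < q / b by rewrite divr_gt0.
have G0 : (0 < egamma (1 + q / b))%E by apply: egamma_gt0; rewrite addr_gt0.
rewrite /epow oppr_lt0 qb0 opprK.
case: x => [x|_|//]; last first.
  rewrite poweRyr ?gt_eqF// invey mule0; apply: integral0_eq => r /=.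
  rewrite in_itv/= andbT => r0.
  by rewrite gt0_mulye ?lte_fin ?powR_gt0//= mule0.
rewrite lee_fin le_eqVlt => /predU1P[<-|x0].
  rewrite poweR0r ?gt_eqF// inve0 gt0_muley//.
  under eq_integral do rewrite mul0e oppe0 expeR0 mule1.
  exact: integral_powR_head_infty.
rewrite poweR_EFin inver gt_eqF ?powR_gt0// -powRN -mellin_expR_pos//.
Qed.

(** Here the integral is 0 at x = 0 and +oo at x = +oo; p < b makes the Gamma factor
    positive, which the value at +oo requires. *)
Lemma mellin_one_sub_expeR (b p : R) (x : \bar R) : 0 < p -> p < b -> (0 <= x)%E ->
  (\int[mu]_(r in `]0%R, +oo[)
     ((p * r `^ (- p - 1))%:E * (1 - expeR (- (x * (r `^ b)%:E)))) =
   egamma (1 - p / b) * x `^ (p / b))%E.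
Proof.
move=> p0 pb; have b0 := lt_trans p0 pb.
have pb0 : 0 < p / b by rewrite divr_gt0.
have G0 : (0 < egamma (1 - p / b))%E.
  by apply: egamma_gt0; rewrite subr_gt0 ltr_pdivrMr// mul1r.
case: x => [x|_|//]; last first.
  rewrite poweRyr ?gt_eqF// gt0_muley//.
  rewrite -[RHS](integral_powR_tail_infty p0); apply: eq_integral => r.
  rewrite inE/= in_itv/= andbT => r0.
  by rewrite gt0_mulye ?lte_fin ?powR_gt0//= oppr0 adde0 mule1.
rewrite lee_fin le_eqVlt => /predU1P[<-|x0].
  rewrite poweR0r ?gt_eqF// mule0; apply: integral0_eq => r _.
  by rewrite mul0e oppe0 expeR0 subee ?mule0.
rewrite poweR_EFin -mellin_one_sub_expR_pos//.
Qed.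

End mellin.

(** * Moments from the Laplace transform exp(- C r^alpha) *)

Lemma measurable_expeR (R : realType) : measurable_fun setT (@expeR R).
Proof.
rewrite (_ : expeR = fun x : \bar R => if x == -oo%E then 0%E else
    if x == +oo%E then +oo%E else (expR (fine x))%:E); last first.
  by apply/funext => -[].
apply: measurable_fun_ifT => //=; first exact: measurable_fun_eqe.
apply: measurable_fun_ifT => //=; first exact: measurable_fun_eqe.
apply/measurable_EFinP; apply: (measurableT_comp (@measurable_expR R)).
exact: fine_measurable.
Qed.

Section moments_of_laplace.
Context (d : measure_display) (T : measurableType d) (R : realType).
Variable P : probability T R.
Local Notation mu := (@lebesgue_measure R).

(** The expectation goes under a Mellin integral.  The measurability of the random
    Mellin integral also yields that of the powers of X. *)
Lemma tonelli_density (g : R -> R) (F : T -> R -> \bar R) :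
  measurable_fun setT g -> (forall r, 0 <= g r) ->
  measurable_fun [set: T * R] (fun z : T * R => F z.1 z.2) ->
  (forall w r, 0 < r -> (0 <= F w r)%E) ->
  measurable_fun setT
    (fun w => \int[mu]_(r in `]0%R, +oo[) ((g r)%:E * F w r))%E /\
  (\int[P]_w \int[mu]_(r in `]0%R, +oo[) ((g r)%:E * F w r) =
   \int[mu]_(r in `]0%R, +oo[) ((g r)%:E * \int[P]_w F w r))%E.
Proof.
move=> mg g0 mF F0.
pose D : set R := `]0, +oo[%classic.
have mD : measurable D by exact: measurable_itv.
pose f (z : T * R) : \bar R := ((\1_D z.2)%:E * ((g z.2)%:E * F z.1 z.2))%E.
have mf : measurable_fun [set: (T * R)%type] f.
  apply: emeasurable_funM.
    by apply/measurable_EFinP; apply: (measurableT_comp (measurable_indic mD)).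
  apply: emeasurable_funM => //.
  by apply/measurable_EFinP; exact: (measurableT_comp mg).
have f0 z : (0 <= f z)%E.
  rewrite /f indicE; case: (boolP (z.2 \in D)) => [|_]; last by rewrite mul0e.
  rewrite inE /D/= in_itv/= andbT => z0.
  by rewrite !mule_ge0 ?lee_fin//; exact: F0.
have fE w : (\int[mu]_r f (w, r) = \int[mu]_(r in `]0%R, +oo[) ((g r)%:E * F w r))%E.
  rewrite [RHS]integral_mkcond; apply: eq_integral => r _.
  by rewrite /f/= indicE patchE; case: ifP => _; rewrite ?mul1e ?mul0e.
split.
  have := measurable_fun_fubini_tonelli_F (m2 := mu) f mf f0.
  by apply: eq_measurable_fun => w _; rewrite -fE.
transitivity (\int[P]_w \int[mu]_r f (w, r))%E; first by apply: eq_integral => w _.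
rewrite (fubini_tonelli (m1 := P) (m2 := mu) f mf f0).
rewrite [RHS]integral_mkcond; apply: eq_integral => r _.
rewrite patchE; case: ifPn => rD; last first.
  by apply: integral0_eq => w _; rewrite /f/= indicE (negbTE rD) mul0e.
rewrite -ge0_integralZl_EFin//.
- by apply: eq_integral => w _; rewrite /f/= indicE rD mul1e.
- by move=> w _; apply: F0; move: rD; rewrite inE/= in_itv/= andbT.
- exact: (measurableT_comp mF (pair2_measurable r)).
Qed.

Variables (alpha : R) (alpha_gt0 : 0 < alpha) (alpha_lt1 : alpha < 1).
Variables (X : T -> \bar R) (C : \bar R).
Hypotheses (mX : measurable_fun setT X) (X0 : forall w, (0 <= X w)%E) (C0 : (0 <= C)%E).
Hypothesis laplaceX : forall r, 0 < r ->
  (\int[P]_w expeR (- (X w * r%:E)) = expeR (- (C * (r `^ alpha)%:E)))%E.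

Let F (w : T) (r : R) : \bar R := expeR (- (X w * r%:E)).

Let mF : measurable_fun [set: T * R] (fun z : T * R => F z.1 z.2).
Proof.
apply: (measurableT_comp (@measurable_expeR R)).
apply: (measurableT_comp (@oppe_measurable R setT)).
apply: emeasurable_funM; first exact: (measurableT_comp mX).
by apply/measurable_EFinP; exact: measurable_snd.
Qed.

Let F_le1 w r : 0 < r -> (F w r <= 1)%E.
Proof.
move=> r0; rewrite /F -expeR0 lee_expeR oppe_le0 mule_ge0//.
by rewrite lee_fin ltW.
Qed.

Let moment_of_identity (p : R) (c : R) (I : T -> \bar R) : 0 < c ->
  measurable_fun setT I -> (forall w, 0 <= I w)%E ->
  (forall w, I w = c%:E * epow (X w) p)%E ->
  (c%:E * \int[P]_w epow (X w) p = \int[P]_w I w)%E.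
Proof.
move=> c0 mI I0 IE.
have XE w : epow (X w) p = (c^-1%:E * I w)%E.
  by rewrite IE muleA -EFinM mulVf ?gt_eqF// mul1e.
under eq_integral do rewrite XE.
rewrite ge0_integralZl_EFin ?invr_ge0 ?ltW//.
by rewrite muleA -EFinM divff ?gt_eqF// mul1e.
Qed.

Let EFin_divl (a b : R) (x y : \bar R) : 0 < a ->
  (a%:E * x = b%:E * y)%E -> x = ((b / a)%:E * y)%E.
Proof.
move=> a0 h; rewrite mulrC EFinM -muleA -h muleA -EFinM mulVf ?gt_eqF//.
by rewrite mul1e.
Qed.

Let Gamma_gt0 (z : R) : 0 < z -> 0 < Gamma z.
Proof. by move=> z0; rewrite -lte_fin GammaE// egamma_gt0. Qed.

Lemma moment_neg (p : R) : p < 0 ->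
  (\int[P]_w epow (X w) p =
   (Gamma (1 - p / alpha) / Gamma (1 - p))%:E * epow C (p / alpha))%E.
Proof.
move=> p0; have q0 : 0 < - p by rewrite oppr_gt0.
pose g (r : R) : R := - p * r `^ (- p - 1).
have mg : measurable_fun setT g.
  by apply: measurable_funM => //; exact: measurable_powR.
have g0 r : 0 <= g r by rewrite mulr_ge0 ?powR_ge0// ltW.
have [mI IE] := tonelli_density mg g0 mF (fun w r _ => expeR_ge0 _).
have pa : 0 < 1 - p / alpha.
  by rewrite subr_gt0 (lt_trans _ ltr01)// pmulr_llt0 ?invr_gt0.
have p1 : 0 < 1 - p by rewrite subr_gt0 (lt_trans p0).
apply: EFin_divl; first exact: Gamma_gt0.
rewrite (moment_of_identity (Gamma_gt0 p1) mI)//; last 2 first.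
- move=> w; apply: integral_ge0 => r _.
  by rewrite mule_ge0 ?expeR_ge0// lee_fin.
- move=> w; rewrite GammaE//; have := mellin_expeR ltr01 q0 (X0 w).
  rewrite !divr1 opprK => <-; apply: eq_integral => r.
  by rewrite inE/= in_itv/= andbT => r0; rewrite /F powRr1// ltW.
rewrite IE GammaE//; have := mellin_expeR alpha_gt0 q0 C0.
rewrite mulNr opprK => <-; apply: eq_integral => r.
by rewrite inE/= in_itv/= andbT => r0; rewrite laplaceX.
Qed.

Lemma moment_pos (p : R) : 0 < p -> p < alpha ->
  (\int[P]_w epow (X w) p =
   (Gamma (1 - p / alpha) / Gamma (1 - p))%:E * epow C (p / alpha))%E.
Proof.
move=> p0 palpha.
pose g (r : R) : R := p * r `^ (- p - 1).
have mg : measurable_fun setT g.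
  by apply: measurable_funM => //; exact: measurable_powR.
have g0 r : 0 <= g r by rewrite mulr_ge0 ?powR_ge0// ltW.
have p1 : p < 1 by exact: lt_trans alpha_lt1.
have mF1 : measurable_fun [set: T * R] (fun z : T * R => 1 - F z.1 z.2)%E.
  by apply: emeasurable_funB.
have F10 w r : 0 < r -> (0 <= 1 - F w r)%E.
  move=> r0; rewrite sube_ge0; first exact: F_le1.
  by rewrite orbC.
have [mI IE] := tonelli_density mg g0 mF1 F10.
have pa : 0 < 1 - p / alpha by rewrite subr_gt0 ltr_pdivrMr// mul1r.
have pp : 0 < 1 - p by rewrite subr_gt0.
apply: EFin_divl; first exact: Gamma_gt0.
rewrite (moment_of_identity (Gamma_gt0 pp) mI)//; last 2 first.
- move=> w; apply: integral_ge0 => r /=; rewrite in_itv/= andbT => r0.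
  by rewrite mule_ge0 ?F10// lee_fin.
- move=> w; rewrite GammaE//; have := mellin_one_sub_expeR p0 p1 (X0 w).
  rewrite !divr1 /epow ltNge (ltW p0)/= => <-; apply: eq_integral => r.
  by rewrite inE/= in_itv/= andbT => r0; rewrite /F powRr1// ltW.
rewrite IE GammaE//; have := mellin_one_sub_expeR p0 palpha C0.
have pa0 : (p / alpha < 0) = false by apply/negbTE; rewrite -leNgt divr_ge0// ltW.
rewrite /epow pa0 => <-; apply: eq_integral => r.
rewrite inE/= in_itv/= andbT => r0; congr (_ * _)%E; rewrite -laplaceX//.
have mFr : measurable_fun setT (F ^~ r).
  exact: (measurableT_comp mF (pair2_measurable r)).
have PF1 : (\int[P]_w F w r <= 1)%E.
  rewrite -(@probability_setT _ _ _ P) -[leRHS]mul1e -integral_cst//.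
  apply: ge0_le_integral => //.
  - by move=> w _; exact: expeR_ge0.
  - by move=> w _; exact: F_le1.
have PF : (\int[P]_w F w r)%E \is a fin_num.
  rewrite ge0_fin_numE ?(le_lt_trans PF1) ?ltry//.
  by apply: integral_ge0 => w _; exact: expeR_ge0.
have F_fin w : F w r \is a fin_num.
  by rewrite ge0_fin_numE ?expeR_ge0// (le_lt_trans (F_le1 w r0))// ltry.
have m1F : measurable_fun setT (fun w => 1 - F w r)%E.
  exact: (measurableT_comp mF1 (pair2_measurable r)).
have total : ((\int[P]_w (1 - F w r)) + (\int[P]_w F w r) = 1)%E.
  rewrite -ge0_integralD//=; last 2 first.
  - by move=> w _; exact: F10.
  - by move=> w _; exact: expeR_ge0.
  under eq_integral do rewrite subeK//.
  by rewrite integral_cst// mul1e; exact: probability_setT.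
by rewrite -[X in (_ = X - _)%E]total addeK.
Qed.

(** If the p-th moment were finite, X^q <= 1 + X^p would bound the q-th moments
    uniformly in q < alpha; by [moment_pos] they are at least a constant times
    1 / (1 - q/alpha). *)
Lemma moment_infty (p : R) : alpha <= p -> (0 < C)%E ->
  (\int[P]_w epow (X w) p = +oo)%E.
Proof.
move=> alphap Cpos; have p0 : 0 < p by exact: lt_le_trans alphap.
have mXp q : measurable_fun setT (fun w => X w `^ q)%E.
  exact: (measurableT_comp (measurable_poweR q) mX).
rewrite (_ : (\int[P]_w _ = \int[P]_w (X w `^ p))%E); last first.
  by apply: eq_integral => w _; rewrite /epow ltNge (ltW p0).
have le_moment q : 0 < q -> q < alpha ->
    (\int[P]_w (X w `^ q) <= 1 + \int[P]_w (X w `^ p))%E.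
  move=> q0 qalpha.
  rewrite -[X in (_ <= X + _)%E](_ : (\int[P]_w (cst 1 w) = 1)%E); last first.
    by rewrite integral_cst// mul1e; exact: probability_setT.
  rewrite -ge0_integralD//; last by move=> w _; exact: poweR_ge0.
  apply: ge0_le_integral => //.
  - by move=> w _; exact: poweR_ge0.
  - by apply: emeasurable_funD.
  - move=> w _; case: (X w) (X0 w) => [x|_|//].
    + rewrite !poweR_EFin !lee_fin => x0.
      have [x1|x1] := leP x 1.
        rewrite (@le_trans _ _ 1) ?lerDl ?powR_ge0//.
        have := @ge0_ler_powR _ q (ltW q0) x 1; rewrite powR1; apply=> //.
        by rewrite nnegrE.
      by rewrite (le_trans (ler_powR (ltW x1) (ltW (lt_le_trans qalpha alphap))))// lerDr.
    + by rewrite !poweRyr ?gt_eqF.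
(* c = min(C, 1) is a lower bound of C^theta for every theta in [0, 1] *)
have [c [c0 c1 cC]] : exists c : R, [/\ 0 < c, c <= 1 & (c%:E <= C)%E].
  case: C Cpos => [x|_|//]; last by exists 1; rewrite leey.
  rewrite lte_fin => x0; exists (Num.min x 1); rewrite lt_min x0 ltr01.
  by rewrite lee_fin !ge_min !lexx orbT.
apply/eqP; rewrite -leye_eq leNgt; apply/negP => lty.
have fin : (\int[P]_w (X w `^ p))%E \is a fin_num.
  by rewrite ge0_fin_numE//; apply: integral_ge0 => w _; exact: poweR_ge0.
move: le_moment; rewrite -(fineK fin) -EFinD.
set M := fine _ => le_moment.
(* bounds Gamma(1 - q) for 0 < q < alpha *)
pose K := (1 - alpha)^-1 + 1.
(* theta stands for q / alpha *)
have bound theta : 0 < theta -> theta < 1 ->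
    expR (-1) * c / (1 - theta) <= (1 + M) * K.
  move=> t0 t1; pose q := theta * alpha.
  have q0 : 0 < q by rewrite mulr_gt0.
  have qalpha : q < alpha by rewrite gtr_pMl.
  have q1 : 0 < 1 - q by rewrite subr_gt0 (lt_trans qalpha).
  have qK : q / alpha = theta by rewrite mulfK// gt_eqF.
  have := le_moment _ q0 qalpha.
  rewrite (_ : (\int[P]_w _ = \int[P]_w (epow (X w) q))%E); last first.
    by apply: eq_integral => w _; rewrite /epow ltNge (ltW q0).
  rewrite moment_pos// qK /epow (ltNge theta) (ltW t0)/=.
  have cCt : (c%:E <= C `^ theta)%E.
    apply: (@le_trans _ _ (c `^ theta)%:E).
      by rewrite lee_fin -[leLHS](powRr1 (ltW c0)) ger_powR ?c0//= ltW.
    rewrite -poweR_EFin; apply: gt0_ler_poweR => //; first exact: ltW.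
      by rewrite in_itv/= leey lee_fin ltW.
    by rewrite in_itv/= leey C0.
  have gq0 : (0 <= (Gamma (1 - theta) / Gamma (1 - q))%:E)%E.
    by rewrite lee_fin divr_ge0// ltW// Gamma_gt0// subr_gt0.
  move=> /(le_trans (lee_wpmul2l gq0 cCt)).
  rewrite -EFinM lee_fin => h.
  have G1 : expR (-1) / (1 - theta) <= Gamma (1 - theta).
    by rewrite -lee_fin GammaE ?egamma_ge ?subr_gt0.
  have G2 : Gamma (1 - q) <= K.
    rewrite -lee_fin GammaE//; apply: le_trans (egamma_le q1 _) _.
      by rewrite gerBl ltW.
    by rewrite lee_fin lerD2r lef_pV2 ?posrE// ?subr_gt0// lerB// ltW.
  have M1 : 0 <= 1 + M.
    rewrite addr_ge0// -lee_fin fineK//.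
    by apply: integral_ge0 => w _; exact: poweR_ge0.
  apply: (@le_trans _ _ ((1 + M) * Gamma (1 - q))); last by rewrite ler_wpM2l.
  rewrite -ler_pdivrMr ?Gamma_gt0//; apply: le_trans h.
  rewrite [leRHS]mulrAC ler_pM2r ?invr_gt0 ?Gamma_gt0//.
  by rewrite mulrAC ler_pM2r.
move: bound; set L := (1 + M) * K; set a := expR (-1) * c => bound.
have a0 : 0 < a by rewrite mulr_gt0 ?expR_gt0.
have aL : a * 2 <= L.
  have := bound 2^-1; rewrite (_ : 1 - 2^-1 = 2^-1) ?invrK; last by field.
  by apply; [rewrite invr_gt0|rewrite invf_lt1// ltr1n].
have L0 : 0 < L by apply: lt_le_trans aL; rewrite mulr_gt0.
(* this theta makes the left-hand side of the bound equal to 2 L *)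
have := bound (1 - a / (2 * L)).
clearbody a L.
have ub : a / (2 * L) < 1 by rewrite ltr_pdivrMr ?mulr_gt0//; lra.
have lb : 0 < a / (2 * L) by rewrite divr_gt0 ?mulr_gt0.
rewrite subKr (_ : a / (a / (2 * L)) = 2 * L); last by field; rewrite !gt_eqF.
rewrite subr_gt0 ub gtrBl lb => /(_ isT isT).
lra.
Qed.

End moments_of_laplace.

(** * Expectation of a product of independent variables *)

Section independence.
Context (d : measure_display) (T : measurableType d) (R : realType).
Variable P : probability T R.
Local Notation mu := (@lebesgue_measure R).

Lemma integral_layer (y : R) : 0 <= y ->
  (\int[mu]_(s in `]0%R, +oo[ `&` [set s | (s < y)%R]) (1%R)%:E = y%:E)%E.
Proof.
move=> y0; rewrite (_ : _ `&` _ = `]0, y[%classic); last first.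
  apply/seteqP; split => s /=; rewrite !in_itv/= ?andbT; first by case=> -> ->.
  by case/andP.
rewrite integral_cst//= mul1e lebesgue_measure_itv/= lte_fin.
by move: y0; rewrite le_eqVlt => /predU1P[<-|->]; rewrite ?ltxx// oppr0 adde0.
Qed.

Lemma integral_layer_cake (Y g : T -> R) :
  measurable_fun setT Y -> measurable_fun setT g ->
  (forall w, 0 <= Y w) -> (forall w, 0 <= g w) ->
  (\int[P]_w (Y w * g w)%:E =
   \int[mu]_(s in `]0%R, +oo[) \int[P]_(w in [set w | (s < g w)%R]) (Y w)%:E)%E.
Proof.
move=> mY mg Y0 g0.
have mb : measurable_fun [set: T * R] (fun z : T * R => z.2 < g z.1).
  by apply: measurable_fun_ltr; [exact: measurable_snd|exact: (measurableT_comp mg)].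
have := @tonelli_relation _ _ _ _ _ P mu setT _ Y (cst 1) (fun w s => s < g w)
  measurableT (measurable_itv `]0, +oo[) mY (@measurable_cst _ _ _ _ _ _) mb Y0
  (fun _ => ler01).
move=> H; transitivity (\int[P]_w ((Y w)%:E *
    \int[mu]_(s in `]0%R, +oo[ `&` [set s | (s < g w)%R]) (1%R)%:E))%E.
  by apply: eq_integral => w _; rewrite integral_layer// EFinM.
by rewrite H; apply: eq_integral => s _; rewrite mul1e setTI.
Qed.

(** By the layer-cake formula both sides are integrals over s > 0 of quantities
    attached to the events s < g, so factorization on these events suffices. *)
Lemma integral_mul_independent (Y g : T -> R) :
  measurable_fun setT Y -> (forall w, 0 <= Y w) ->
  measurable_fun setT g -> (forall w, 0 <= g w) ->
  (forall s, \int[P]_(w in [set w | (s < g w)%R]) (Y w)%:E =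
     (\int[P]_w (Y w)%:E) * P [set w | (s < g w)%R])%E ->
  (\int[P]_w (Y w * g w)%:E = (\int[P]_w (Y w)%:E) * \int[P]_w (g w)%:E)%E.
Proof.
move=> mY Y0 mg g0 H.
have mgs s : measurable [set w | s < g w].
  have := mg measurableT _ (measurable_itv `]s, +oo[); rewrite setTI.
  by congr measurable; apply/seteqP; split=> w /=; rewrite in_itv/= andbT.
rewrite integral_layer_cake//; under eq_integral do rewrite H.
have <- : (\int[mu]_(s in `]0%R, +oo[) P [set w | (s < g w)%R] = \int[P]_w (g w)%:E)%E.
  transitivity (\int[P]_w (1 * g w)%:E)%E; last by under eq_integral do rewrite mul1r.
  rewrite integral_layer_cake//; apply: eq_integral => s _.
  by rewrite integral_cst// mul1e.
rewrite ge0_integralZl//; last by apply: integral_ge0 => w _; rewrite lee_fin.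
apply: measurable_funTS.
have mA : measurable [set z : T * R | z.2 < g z.1].
  have mb : measurable_fun [set: T * R] (fun z : T * R => z.2 < g z.1).
    by apply: measurable_fun_ltr; [exact: measurable_snd|exact: (measurableT_comp mg)].
  by have := mb measurableT [set true] Logic.I; rewrite setTI.
have := measurable_fun_ysection P mA; apply: eq_measurable_fun => s _ /=.
by congr (P _); apply/seteqP; split => w; rewrite /ysection/= inE.
Qed.

(** For indicators this is the definition of independence.  One coordinate after
    the other, the indicator is replaced by an arbitrary function: claim k treats
    families in which the functions of index at least k are indicators. *)
Lemma expectation_prod_independent (n : nat) (X : 'I_n -> T -> R) (g : 'I_n -> R -> R) :
  mutually_independent P X -> (forall i, measurable_fun setT (X i)) ->
  (forall i, measurable_fun setT (g i)) -> (forall i x, 0 <= g i x) ->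
  (\int[P]_w (\prod_i g i (X i w))%:E = \prod_i \int[P]_w (g i (X i w))%:E)%E.
Proof.
move=> indX mX.
have intI (B : set R) (i : 'I_n) : measurable B ->
    (\int[P]_w (\1_B (X i w))%:E = P (X i @^-1` B))%E.
  move=> mB; have mXB : measurable (X i @^-1` B).
    by rewrite -[X in measurable X]setTI; exact: mX.
  by have := integral_indic P measurableT mXB; rewrite setIT => <-.
suff claim k : forall h : 'I_n -> R -> R,
    (forall i, measurable_fun setT (h i)) -> (forall i x, 0 <= h i x) ->
    (forall i : 'I_n, (k <= i)%N -> exists2 B, measurable B & h i = \1_B) ->
    (\int[P]_w (\prod_i h i (X i w))%:E = \prod_i \int[P]_w (h i (X i w))%:E)%E.
  by move=> mg g0; apply: (claim n) => // i; rewrite leqNgt ltn_ord.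
elim: k => [h mh h0 hI|k ih h mh h0 hI].
  have /choice[B BE] i : exists B, measurable B /\ h i = \1_B.
    by have [B mB hB] := hI i isT; exists B.
  have := indX [set: 'I_n]%SET B (fun i => (BE i).1).
  rewrite (eq_bigl xpredT); last by move=> i; rewrite inE.
  move=> indE; rewrite [RHS](eq_bigr (fun i => P (X i @^-1` B i))); last first.
    by move=> i _; rewrite (BE i).2 intI//; exact: (BE i).1.
  rewrite -indE; set A := \bigcap_(i in _) _.
  have mA : measurable A.
    apply: fin_bigcap_measurable; first exact: finite_finset.
    by move=> i _; rewrite -[X in measurable X]setTI; apply: mX => //; exact: (BE i).1.
  have := integral_indic P measurableT mA; rewrite setIT => <-.
  apply: eq_integral => w _; rewrite indicE; congr EFin.
  under eq_bigr => i _ do rewrite (BE i).2 indicE.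
  case: (boolP (w \in A)) => wA.
    by rewrite big1// => i _; rewrite mem_set//; move: wA; rewrite inE; apply; rewrite /= inE.
  have [i iA] : exists i, ~ B i (X i w).
    by apply/existsNP => wB; move: wA; rewrite notin_setE; apply => i _; exact: wB.
  by rewrite (bigD1 i)//= memNset// mul0r.
have [nk|kn] := leqP n k.
  by apply: ih => // i ki; move: (leq_ltn_trans ki (ltn_ord i)); rewrite ltnNge nk.
pose i0 := Ordinal kn.
pose Y w := \prod_(i | i != i0) h i (X i w).
have mY : measurable_fun setT Y.
  have -> : Y = fun w => \prod_i (if i == i0 then 1 else h i (X i w)).
    apply/funext => w; rewrite [RHS](bigD1 i0)//= eqxx mul1r.
    by apply: eq_bigr => i /negbTE ->.
  apply: measurable_prod => i _; case: (i == i0); first exact: measurable_cst.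
  exact: measurableT_comp.
have Y0 w : 0 <= Y w by apply: prodr_ge0 => i _; exact: h0.
pose c : \bar R := (\prod_(i | i != i0) \int[P]_w (h i (X i w))%:E)%E.
(* induction hypothesis, with h i0 replaced by an indicator *)
have key (B : set R) : measurable B ->
    (\int[P]_w (Y w * \1_B (X i0 w))%:E = c * P (X i0 @^-1` B))%E.
  move=> mB; pose h' i := if i == i0 then \1_B else h i.
  have mh' i : measurable_fun setT (h' i).
    by rewrite /h'; case: ifP => _; [exact: measurable_indic|exact: mh].
  have h'0 i x : 0 <= h' i x by rewrite /h'; case: ifP => _.
  have h'I (i : 'I_n) : (k <= i)%N -> exists2 B, measurable B & h' i = \1_B.
    rewrite /h' leq_eqVlt; case: ifPn => [_ _|ii0]; first by exists B.
    case/predU1P => [ki|]; last exact: hI.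
    by move: ii0; rewrite -val_eqE/= -ki eqxx.
  have := ih h' mh' h'0 h'I.
  rewrite (bigD1 i0)//= [h' i0]/h' eqxx intI// muleC.
  under eq_bigr => i /negbTE ii0 do rewrite /h' ii0.
  rewrite -/c => <-; apply: eq_integral => w _; rewrite (bigD1 i0)//=.
  rewrite {1}/h' eqxx mulrC; congr (_ * _)%:E.
  by apply: eq_bigr => i /negbTE ii0; rewrite /h' ii0.
have cE : (\int[P]_w (Y w)%:E = c)%E.
  have := key setT measurableT.
  rewrite preimage_setT [P _](@probability_setT _ _ _ P) mule1 => <-.
  by apply: eq_integral => w _; rewrite indicT mulr1.
rewrite (bigD1 i0)//= -/c.
transitivity (\int[P]_w (Y w * h i0 (X i0 w))%:E)%E.
  by apply: eq_integral => w _; rewrite (bigD1 i0)//= mulrC.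
rewrite (@integral_mul_independent Y (fun w => h i0 (X i0 w)))//.
- by rewrite muleC cE.
- exact: measurableT_comp.
- move=> s; rewrite cE.
  have mB : measurable [set x | s < h i0 x].
    have := mh i0 measurableT _ (measurable_itv `]s, +oo[); rewrite setTI.
    by congr measurable; apply/seteqP; split=> x /=; rewrite in_itv/= andbT.
  rewrite -(key _ mB) integral_mkcond; apply: eq_integral => w _.
  rewrite patchE indicE; case: ifPn => wB.
    by rewrite mem_set ?mulr1//; move: wB; rewrite inE.
  by rewrite memNset ?mulr0//; move: wB; rewrite notin_setE.
Qed.

End independence.

(** * Bounded Borel functions as iterated limits of continuous ones *)

Section baire_class.
Context {R : realType}.

(** Bounded Baire functions.  Each limit step carries a uniform bound, which is what
    dominated convergence asks for when a property is propagated along the class. *)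
Inductive baire : (R -> R) -> Prop :=
| baire_continuous h (M : R) : continuous h -> (forall x, `|h x| <= M) -> baire h
| baire_limit (h_ : nat -> R -> R) h (M : R) : (forall n, baire (h_ n)) ->
    (forall n x, `|h_ n x| <= M) ->
    (forall x, h_ n x @[n --> \oo] --> h x) -> baire h.

Lemma baire_bounded h : baire h -> exists M, forall x, `|h x| <= M.
Proof.
case=> [{}h M _ hM|h_ {}h M _ hM cvgh]; exists M => // x.
apply: (closed_cvg [set y : R | y <= M] _ _ _ (cvg_norm (cvgh x))).
  exact: closed_le.
by apply: nearW => n; exact: hM.
Qed.

Lemma baire_measurable h : baire h -> measurable_fun setT h.
Proof.
elim=> [{}h M ch _|h_ {}h M _ mh _ cvgh]; first exact: continuous_measurable_fun.
by apply: (measurable_fun_cvg mh) => x _; exact: cvgh.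
Qed.

(** Induction on g for fixed f; when g is continuous, induction on f. *)
Lemma baireD f g : baire f -> baire g -> baire (f \+ g).
Proof.
move=> bf; elim=> [{}g N cg gN|g_ {}g N _ ih gN cvgg].
  elim: bf => [{}f M cf fM|f_ {}f M _ ih fM cvgf].
    apply: (@baire_continuous _ (M + N)).
      by move=> x; apply: cvgD; [exact: cf|exact: cg].
    by move=> x; rewrite (le_trans (ler_normD _ _))// lerD.
  apply: (@baire_limit _ _ (M + N) ih).
    by move=> n x; rewrite (le_trans (ler_normD _ _))// lerD.
  by move=> x; apply: cvgD => //; exact: cvg_cst.
have [M fM] := baire_bounded bf.
apply: (@baire_limit _ _ (M + N) ih).
  by move=> n x; rewrite (le_trans (ler_normD _ _))// lerD.
by move=> x; apply: cvgD => //; exact: cvg_cst.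
Qed.

Lemma baireZ c f : baire f -> baire (fun x => c * f x).
Proof.
elim=> [{}f M cf fM|f_ {}f M _ ih fM cvgf].
  apply: (@baire_continuous _ (`|c| * M)).
    by move=> x; apply: cvgM; [exact: cvg_cst|exact: cf].
  by move=> x; rewrite normrM ler_wpM2l.
apply: (@baire_limit _ _ (`|c| * M) ih).
  by move=> n x; rewrite normrM ler_wpM2l.
by move=> x; apply: cvgM => //; exact: cvg_cst.
Qed.

Lemma baire_cst c : baire (cst c).
Proof. by apply: (@baire_continuous _ `|c|) => // x; exact: cvg_cst. Qed.

Lemma baire_sum (I : Type) (s : seq I) (f : I -> R -> R) :
  (forall i, baire (f i)) -> baire (fun x => \sum_(i <- s) f i x).
Proof.
move=> bf; elim: s => [|i s ih].
  by under eq_fun do rewrite big_nil; exact: baire_cst.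
by under eq_fun do rewrite big_cons; exact: baireD.
Qed.

Lemma baire_indic_ray (x : R) : baire (\1_(`]x, +oo[%classic)).
Proof.
(* t is twice the positive part of y - x, so 1 - exp(- n t) tends to the
   indicator of t > 0 *)
pose t (y : R) := (y - x) + `|y - x|.
have t0 y : 0 <= t y by rewrite /t -lerBlDl sub0r -normrN ler_norm.
have le1 n y : `|1 - expR (- (n%:R * t y))| <= 1.
  have e1 : expR (- (n%:R * t y)) <= 1 by rewrite expR_le1 oppr_le0 mulr_ge0.
  by rewrite ger0_norm ?subr_ge0// gerBl expR_ge0.
apply: (@baire_limit (fun n y => 1 - expR (- (n%:R * t y))) _ 1).
- move=> n; apply: (@baire_continuous _ 1) => y.
    apply: (@cvgB _ R); first exact: cvg_cst.
    apply: continuous_cvg; first exact: continuous_expR.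
    apply: cvgN; apply: cvgM; first exact: cvg_cst.
    have cyx : y - x @[y --> y] --> y - x.
      by apply: (@cvgB _ R); [exact: cvg_id|exact: cvg_cst].
    by apply: cvgD => //; exact: cvg_norm.
  exact: le1.
- exact: le1.
- move=> y; rewrite indicE.
  case: (boolP (y \in _)); rewrite ?notin_setE ?inE/= in_itv/= andbT => xy.
    rewrite -[X in _ --> X]subr0; apply: (@cvgB _ R); first exact: cvg_cst.
    under eq_fun do rewrite -mulrN expRM_natl.
    apply: cvg_expr; rewrite ger0_norm ?expR_ge0// expR_lt1 oppr_lt0.
    by rewrite /t ger0_norm ?subr_ge0 ?ltW// addr_gt0 ?subr_gt0.
  apply: cvg_near_cst; apply: nearW => n.
  move/negP: xy; rewrite -leNgt => yx.
  by rewrite /t ler0_norm ?subr_le0// subrr mulr0 oppr0 expR0 subrr.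
Qed.

(** The pi-lambda theorem: rays are stable under intersection and generate the Borel
    sets, and the sums and limits of Baire functions make the sets with a Baire
    indicator a lambda-system. *)
Lemma baire_indic (A : set R) : measurable A -> baire (\1_A).
Proof.
move=> mA; have : (@RGenOInfty.G R).-sigma.-measurable A.
  by rewrite -RGenOInfty.measurableE.
apply: (@lambda_system_subset _ (@RGenOInfty.G R) _ setT (fun A => baire (\1_A))) => //.
- move=> _ _ [x ->] [y ->]; exists (Num.max x y).
  by apply/seteqP; split => z /=; rewrite !in_itv/= !andbT gt_max;
    [case=> -> ->|case/andP].
- split => //.
  + by rewrite indicT; exact: baire_cst.
  + move=> A' B BA bA bB.
    rewrite (_ : \1_(A' `\` B) = \1_A' \+ (fun x => -1 * \1_B x)).
      by apply: baireD => //; exact: baireZ.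
    apply/funext => x /=; rewrite mulN1r !indicE in_setD.
    case: (boolP (x \in B)) => xB/=; last by rewrite andbT subr0.
    by rewrite andbF mem_set ?subrr//; apply: BA; rewrite inE in xB.
  + move=> F ndF bF; apply: (@baire_limit (fun n => \1_(F n)) _ 1) => //.
      by move=> n x; rewrite indicE; case: (_ \in _); rewrite ?normr1 ?normr0.
    move=> x; apply: cvg_near_cst; rewrite !indicE.
    have [[k _ Fkx]|nF] := pselect ((\bigcup_k F k) x).
      rewrite mem_set; last by exists k.
      exists k => // n /= kn; rewrite indicE mem_set//.
      by have := ndF _ _ kn; rewrite subsetEset; apply.
    apply: nearW => n; rewrite indicE !memNset// => Fnx.
    by apply: nF; exists n.
- by move=> _ [x ->]; exact: baire_indic_ray.
Qed.

Import HBNNSimple.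

(** A nonnegative function is a limit of simple functions bounded by it; adding a
    constant makes a bounded function nonnegative. *)
Lemma bounded_measurable_baire (h : R -> R) (M : R) :
  measurable_fun setT h -> (forall x, `|h x| <= M) -> baire h.
Proof.
wlog h0 : h M / forall x, 0 <= h x => [wl mh hM|mh hM].
  have -> : h = (fun x => h x + M) \+ cst (- M) by apply/funext => x /=; rewrite addrK.
  apply: baireD; last exact: baire_cst.
  apply: (wl _ (M + M)).
  - by move=> x; move: (hM x); rewrite ler_norml -lerBlDr sub0r => /andP[].
  - by apply: measurable_funD.
  - move=> x; rewrite (le_trans (ler_normD _ _))// lerD//.
    by rewrite ger0_norm// (le_trans _ (hM x)).
have mEh : measurable_fun setT (EFin \o h) by exact/measurable_EFinP.
pose h_ := nnsfun_approx measurableT mEh.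
pose hn (n : nat) (x : R) : R := h_ n x.
apply: (@baire_limit hn h M).
- move=> n; rewrite (_ : hn n = fun x =>
    \sum_(y <- finmap.enum_fset (fset_set (range (h_ n)))) (y * \1_(h_ n @^-1` [set y]) x)).
    apply: baire_sum => y; apply: baireZ; apply: baire_indic.
    exact: measurable_sfunP.
  by apply/funext => x; rewrite [LHS]fimfunE fsbig_finite.
- move=> n x; rewrite ger0_norm//.
  rewrite (le_trans _ (hM x))// ger0_norm// -lee_fin.
  by rewrite /hn /h_ nnsfun_approxE le_approx// => y _; rewrite lee_fin.
- move=> x; have h0' y : setT y -> (0 <= (EFin \o h) y)%E by rewrite lee_fin.
  exact: (fine_cvg (cvg_nnsfun_approx measurableT mEh h0' (Logic.I : setT x))).
Qed.

End baire_class.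

(** * Limits of Laplace transforms *)

Section limits.
Context {R : realType}.

Lemma cvg_expeR_oppe (u : nat -> \bar R) (l : \bar R) :
  (forall n, 0 <= u n)%E -> u n @[n --> \oo] --> l ->
  expeR (- u n)%E @[n --> \oo] --> expeR (- l)%E.
Proof.
move=> u0; case: l => [l|uy|uNy].
- move=> /fine_cvgP[ufin ul] /=.
  apply: (@cvg_trans _ ((expR (- fine (u n)))%:E @[n --> \oo])).
    apply: near_eq_cvg; near=> n.
    have : u n \is a fin_num by near: n.
    by case: (u n).
  apply: cvg_EFin; first exact: nearW.
  apply: (@continuous_cvg _ _ _ _ _ (fun n => - (fine (u n))) expR).
    exact: continuous_expR.
  exact: cvgN.
- apply/fine_cvgP; split.
    near=> n; case: (u n) (u0 n) => //.
  apply/cvgrPdist_le => e e0; near=> n.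
  rewrite sub0r normrN [X in `|X|]/=.
  have : ((- ln e)%:E <= u n)%E by near: n; exact: cvgey_ge.
  case: (u n) (u0 n) => [r _|_ _|//]; last first.
    by rewrite /= normr0 ltW.
  rewrite lee_fin lerNl ger0_norm ?expR_ge0//= => re.
  by rewrite -(lnK e0) ler_expR.
- have : (0 <= -oo :> \bar R)%E.
    by apply: (cvge_to_ge uNy); exact: nearW.
  by [].
Unshelve. all: by end_near. Qed.

(** At l > 0 the power function is differentiable; at l = 0, u < e^(1/a) forces
    u^a < e. *)
Lemma cvg_powR_ge0 (a : R) (u : nat -> R) (l : R) : 0 < a -> (forall n, 0 <= u n) ->
  u n @[n --> \oo] --> l -> u n `^ a @[n --> \oo] --> l `^ a.
Proof.
move=> a0 u0 ul; have l0 : 0 <= l.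
  by apply: (closed_cvg [set x : R | 0 <= x] _ _ _ ul); [exact: closed_ge|exact: nearW].
move: l0; rewrite le_eqVlt => /predU1P[l0|l0].
  rewrite -l0 powR0 ?gt_eqF//; apply/cvgrPdist_le => e e0; near=> n.
  rewrite sub0r normrN ger0_norm ?powR_ge0//.
  rewrite -[leRHS](powRr1 (ltW e0)) -(mulVf (lt0r_neq0 a0)) powRrM.
  apply: ge0_ler_powR => //; rewrite ?nnegrE ?powR_ge0//; first exact: ltW.
  near: n; move: ul; rewrite -l0 => /cvgrPdist_le/(_ (e `^ a^-1)).
  rewrite powR_gt0// => /(_ isT); apply: filterS => n.
  by rewrite sub0r normrN ger0_norm.
apply: (@continuous_cvg _ _ _ _ _ u (fun x => x `^ a)) ul.
exact: powR_continuous_at.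
Unshelve. all: by end_near. Qed.

Lemma bounded_convergence (d : measure_display) (T : measurableType d)
    (m : {measure set T -> \bar R}) (D : set T) (f_ : nat -> T -> \bar R)
    (f : T -> \bar R) (M : R) :
  0 <= M -> measurable D -> (m D < +oo)%E ->
  (forall n, measurable_fun D (f_ n)) ->
  (forall n x, D x -> (0 <= f_ n x <= M%:E)%E) ->
  (forall x, D x -> f_ n x @[n --> \oo] --> f x) ->
  (\int[m]_(x in D) f_ n x)%E @[n --> \oo] --> (\int[m]_(x in D) f x)%E.
Proof.
move=> M0 mD finD mf fM ff.
apply: (@dominated_cvg _ _ _ _ _ mD _ _ (cst M%:E)) => //.
- apply/integrableP; split; first exact: measurable_cst.
  under eq_integral do rewrite /= ger0_norm//.
  by rewrite integral_cst// lte_mul_pinfty// lee_fin.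
- by move=> n x Dx; have /andP[f0 fM'] := fM n x Dx; rewrite gee0_abs.
Qed.

(** The exponentials are bounded by 1, so pointwise limits of the variables, even
    infinite ones, preserve the shape of the transform. *)
Lemma laplace_limit (d : measure_display) (T : measurableType d)
    (P : probability T R) (Y_ : nat -> T -> \bar R) (Y : T -> \bar R)
    (a_ : nat -> \bar R) (a : \bar R) :
  (forall n, measurable_fun setT (Y_ n)) -> (forall n w, 0 <= Y_ n w)%E ->
  (forall w, Y_ n w @[n --> \oo] --> Y w) ->
  (forall n, 0 <= a_ n)%E -> a_ n @[n --> \oo] --> a ->
  (forall n, \int[P]_w expeR (- Y_ n w) = expeR (- a_ n))%E ->
  measurable_fun setT Y /\ (\int[P]_w expeR (- Y w) = expeR (- a))%E.
Proof.
move=> mY Y0 YY a0 aa H; split.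
  by apply: (emeasurable_fun_cvg _ _ mY) => w _; exact: YY.
have lim1 : (\int[P]_w expeR (- Y_ n w))%E @[n --> \oo] --> (\int[P]_w expeR (- Y w))%E.
  apply: (@bounded_convergence _ _ P setT _ _ 1) => //.
  + by rewrite [X in (X < _)%E](@probability_setT _ _ _ P) ltry.
  + move=> n; apply: (measurableT_comp (@measurable_expeR R)).
    exact: (measurableT_comp (@oppe_measurable R setT)).
  + by move=> n w _; rewrite expeR_ge0 -expeR0 lee_expeR oppe_le0 Y0.
  + by move=> w _; exact: cvg_expeR_oppe.
have /funext E : (fun n => \int[P]_w expeR (- Y_ n w))%E =1 (fun n => expeR (- a_ n)%E).
  exact: H.
rewrite -(cvg_lim _ lim1)// -(cvg_lim _ (cvg_expeR_oppe a0 aa))//.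
by rewrite E.
Qed.

End limits.

(** * Grid steps and truncation *)

Section step_functions.
Context {R : realType}.

(** h is evaluated at the right end of the cell ]k delta, (k+1) delta] that contains
    t: these cells are the ones whose Stieltjes measure is an increment. *)
Definition grid_step (h : R -> R) (delta t : R) : R := h ((Num.ceil (t / delta))%:~R * delta).

Lemma measurable_grid_step h delta : 0 < delta -> measurable_fun setT h ->
  measurable_fun setT (grid_step h delta).
Proof.
move=> d0 mh; apply: (measurableT_comp mh).
apply: nondecreasing_measurable => // x y xy.
by rewrite ler_pM2r// ler_int le_ceil// ler_pM2r// invr_gt0.
Qed.

Lemma grid_stepE h delta k t : 0 < delta -> t \in `](k%:R * delta), (k.+1%:R * delta)] ->
  grid_step h delta t = h (k.+1%:R * delta).
Proof.
move=> d0; rewrite in_itv/= => /andP[kt tk]; rewrite /grid_step.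
suff -> : Num.ceil (t / delta) = k.+1%:Z by [].
apply/eqP; rewrite eq_le ceil_le_int ler_pdivrMr// tk/=.
by rewrite intS lez1D ceil_gt_int ltr_pdivlMr.
Qed.

Lemma cvg_grid_step h delta_ t : {for t, continuous h} -> (forall n, 0 < delta_ n) ->
  delta_ n @[n --> \oo] --> (0 : R) -> grid_step h (delta_ n) t @[n --> \oo] --> h t.
Proof.
move=> ch d0 dl; rewrite /grid_step.
apply: (@continuous_cvg _ _ _ _ _ (fun n => (Num.ceil (t / delta_ n))%:~R * delta_ n) h) ch _.
apply: (@squeeze_cvgr _ _ _ _ (cst t) (fun n => t + delta_ n)).
- apply: nearW => n; have /andP[c1 c2] := ceil_itv (t / delta_ n).
  rewrite -ler_pdivrMr// c2/= -ler_pdivlMr// mulrDl divff ?gt_eqF//.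
  by rewrite -lerBlDr ltW// (le_lt_trans _ c1)// rmorphB.
- exact: cvg_cst.
- by rewrite -[X in _ --> X]addr0; apply: cvgD => //; exact: cvg_cst.
Qed.

Lemma integral_grid_step (mu : {measure set (measurableTypeR R) -> \bar R})
    (h : R -> R) (delta : R) (K : nat) :
  0 < delta -> measurable_fun setT h -> (forall t, 0 <= h t) ->
  (\int[mu]_(t in `]0%R, (K%:R * delta)%R]) (grid_step h delta t)%:E =
   \sum_(k < K) (h (k.+1%:R * delta))%:E *
     mu `](k%:R * delta)%R, (k.+1%:R * delta)%R]%classic)%E.
Proof.
move=> d0 mh h0; have ms := measurable_grid_step d0 mh.
elim: K => [|K ih].
  by rewrite mul0r set_itvoc0 integral_set0 big_ord0.
rewrite big_ord_recr/= -ih.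
have -> : `]0%R, (K.+1%:R * delta)%R]%classic =
    `]0%R, (K%:R * delta)%R] `|` `](K%:R * delta)%R, (K.+1%:R * delta)%R] :> set R.
  apply: itv_bndbnd_setU; rewrite bnd_simp; first by rewrite mulr_ge0// ltW.
  by rewrite ler_pM2r// ler_nat.
rewrite ge0_integral_setU//=; last 3 first.
- by apply: measurable_funTS; exact/measurable_EFinP.
- by move=> t _; rewrite lee_fin h0.
- apply/disj_setPS => t [] /=; rewrite !in_itv/= => /andP[_ t1] /andP[t2 _].
  by move: (le_lt_trans t1 t2); rewrite ltxx.
congr (_ + _)%E.
rewrite -integral_cst//; apply: eq_integral => t.
by rewrite inE => tK; rewrite (grid_stepE h d0 (k := K)).
Qed.

End step_functions.

Section truncation.
Context {R : realType}.

(** Monotone convergence for a support that grows with n; the functions are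
    eventually constant in n at each point, as min(f, n) is. *)
Lemma cvg_integral_truncation (mu : {measure set (measurableTypeR R) -> \bar R})
    (G_ : nat -> R -> R) (G : R -> R) :
  (forall n, measurable_fun setT (G_ n)) -> (forall n t, 0 <= G_ n t) ->
  (forall t, {homo G_^~ t : m n / (m <= n)%N >-> m <= n}) ->
  (forall t, 0 < t -> \forall n \near \oo, G_ n t = G t) ->
  (\int[mu]_(t in `]0%R, n%:R]) (G_ n t)%:E @[n --> \oo] -->
   \int[mu]_(t in `]0%R, +oo[) (G t)%:E)%E.
Proof.
move=> mG G0 ndG GG.
pose D n : set R := `]0, n%:R]%classic.
pose g_ n : R -> \bar R := (fun t => (G_ n t)%:E) \_ (D n).
have gE n : (\int[mu]_(t in `]0%R, n%:R]) (G_ n t)%:E = \int[mu]_(t in `]0%R, +oo[) g_ n t)%E.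
  rewrite [LHS]integral_mkcond [RHS]integral_mkcond; apply: eq_integral => t _.
  rewrite /g_ !patchE; case: ifPn; last by case: ifP.
  by rewrite inE/= in_itv/= => /andP[t0 tn]; rewrite mem_set//= in_itv/= t0.
under eq_fun do rewrite gE.
have limg t : 0 < t -> g_ n t @[n --> \oo] --> (G t)%:E.
  move=> t0; apply: cvg_near_cst; near=> n.
  rewrite /g_ patchE mem_set; first by congr EFin; near: n; exact: GG.
  rewrite /D/= in_itv/= t0/=; near: n; exact: nbhs_infty_ger.
have -> : (\int[mu]_(t in `]0%R, +oo[) (G t)%:E =
    \int[mu]_(t in `]0%R, +oo[) limn (g_ ^~ t))%E.
  apply: eq_integral => t; rewrite inE/= in_itv/= andbT => t0.
  by apply/esym/cvg_lim => //; exact: limg.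
apply: cvg_monotone_convergence => //.
- move=> n; apply: measurable_funTS.
  have mD : measurable (D n) by exact: measurable_itv.
  apply/(measurable_restrictT (fun t => (G_ n t)%:E) mD).
  by apply: measurable_funTS; exact/measurable_EFinP.
- by move=> n t _; rewrite /g_ patchE; case: ifP => // _; rewrite lee_fin.
- move=> t _ m n mn; rewrite /g_ !patchE; case: ifPn => [|_].
    rewrite inE /D/= in_itv/= => /andP[t0 tm]; rewrite mem_set.
      by rewrite lee_fin ndG.
    by rewrite /D/= in_itv/= t0 (le_trans tm)// ler_nat.
  by case: ifP => // _; rewrite lee_fin.
Unshelve. all: by end_near. Qed.

End truncation.

(** * The Laplace functional of a stable subordinator *)

Lemma lebesgue_stieltjes_measure_itvoc (R : realType) (F : cumulative R R) (a b : R) :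
  a <= b -> (lebesgue_stieltjes_measure F `]a, b]%classic = (F b - F a)%:E)%E.
Proof.
move=> ab; rewrite /lebesgue_stieltjes_measure /measure_extension/=.
by rewrite measurable_mu_extE/= ?wlength_itv_bnd//; exact: is_ocitv.
Qed.

Section laplace_functional.
Context (d : measure_display) (T : measurableType d) (R : realType).
Variables (P : probability T R) (alpha : R) (alpha_gt0 : 0 < alpha).
Variables (S : R -> T -> R) (hS : stable_subordinator P alpha S).
Local Notation mu := (@lebesgue_measure R).

Local Notation path w := (path_cumulative (subordinator_increasing hS w)
  (levy_cadlag (subordinator_levy hS) w)).
Local Notation m w := (lebesgue_stieltjes_measure (path w)).

Lemma stieltjes_measure_itv w a b : 0 <= a -> a <= b ->
  (m w `]a, b]%classic = (S b w - S a w)%:E)%E.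
Proof.
move=> a0 ab; rewrite lebesgue_stieltjes_measure_itvoc//= /path_ext !max_l//.
exact: le_trans ab.
Qed.

Lemma measurable_increment a b : 0 <= a -> 0 <= b ->
  measurable_fun setT (fun w => S b w - S a w).
Proof.
move=> a0 b0; have ml := levy_measurable (subordinator_levy hS).
by apply: measurable_funB; exact: ml.
Qed.

(** Stationarity says that the increment has the law of S delta - S 0; the case
    c = 0 is separate because the Laplace transform is given for r > 0. *)
Lemma laplace_increment (c a delta : R) : 0 <= c -> 0 <= a -> 0 <= delta ->
  (\int[P]_w (expR (- (c * (S (a + delta) w - S a w))))%:E =
   (expR (- (c `^ alpha * delta)))%:E)%E.
Proof.
move=> c0 a0 d0.
have ad0 : 0 <= a + delta by rewrite addr_ge0.
pose g (x : R) : \bar R := (expR (- (c * x)))%:E.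
have mg : measurable_fun setT g.
  apply/measurable_EFinP; apply: (measurableT_comp (@measurable_expR R)).
  by apply: (measurableT_comp (@oppr_measurable R setT)); exact: mulrl_measurable.
have m1 := measurable_increment a0 ad0.
have m2 := measurable_increment (lexx 0) d0.
transitivity (\int[P]_w g (S delta w - S 0 w)%R)%E.
  rewrite -[LHS](@ge0_integral_pushforward _ _ _ _ _ _ m1 P setT g)//; last first.
    by move=> x _; rewrite lee_fin expR_ge0.
  rewrite -[RHS](@ge0_integral_pushforward _ _ _ _ _ _ m2 P setT g)//; last first.
    by move=> x _; rewrite lee_fin expR_ge0.
  apply: eq_measure_integral => A mA _.
  have := levy_stationary_increments (subordinator_levy hS) a0 _ mA.
  move=> /(_ (a + delta)); rewrite lerDl => /(_ d0).
  by rewrite addrAC subrr add0r.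
under eq_integral do rewrite /g (levy_start (subordinator_levy hS)) subr0.
move: c0; rewrite le_eqVlt => /predU1P[<-|c0].
  under eq_integral do rewrite mul0r oppr0 expR0.
  rewrite powR0 ?gt_eqF// mul0r oppr0 expR0 integral_cst// mul1e.
  exact: probability_setT.
have := subordinator_laplace hS c0 d0; rewrite unlock => H.
rewrite (mulrC (c `^ alpha)) -mulNr -H; apply: eq_integral => w _.
by rewrite mulNr.
Qed.

Lemma laplace_increments (c : nat -> R) (delta : R) (K : nat) :
  (forall k, 0 <= c k) -> 0 <= delta ->
  (\int[P]_w (expR (- \sum_(k < K)
      c k * (S (k.+1%:R * delta) w - S (k%:R * delta) w)))%:E =
   (expR (- \sum_(k < K) c k `^ alpha * delta))%:E)%E.
Proof.
move=> c0 d0.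
have t0 k : 0 <= k%:R * delta by rewrite mulr_ge0.
have ind := @levy_independent_increments _ _ _ _ _ (subordinator_levy hS) K
  (fun k => k%:R * delta) (t0 0%N) _.
have {}ind := ind _.
pose X (i : 'I_K) w := S (i.+1%:R * delta) w - S (i%:R * delta) w.
pose g (i : 'I_K) (x : R) := expR (- (c i * x)).
have mX i : measurable_fun setT (X i) by exact: measurable_increment.
have mg i : measurable_fun setT (g i).
  apply: (measurableT_comp (@measurable_expR R)).
  by apply: (measurableT_comp (@oppr_measurable R setT)); exact: mulrl_measurable.
have g0 i x : 0 <= g i x by exact: expR_ge0.
transitivity (\int[P]_w (\prod_i g i (X i w))%:E)%E.
  apply: eq_integral => w _; rewrite -sumrN expR_sum.
  by congr EFin; apply: eq_bigr.
rewrite (expectation_prod_independent _ mX mg g0); last first.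
  by apply: ind => i j ij; rewrite ler_wpM2r// ler_nat.
rewrite -sumrN expR_sum -prodEFin; apply: eq_bigr => i _.
rewrite -(laplace_increment (c0 i) (t0 i) d0); apply: eq_integral => w _.
by rewrite /g /X -[in i.+1%:R]natr1 mulrDl mul1r.
Qed.

(** The Laplace identity on ]0, N] for the positive part of h.  Signed h are allowed
    because the Baire class is built with differences; the bounded interval has
    finite measure for every path, as dominated convergence requires. *)
Definition laplace_at (N : nat) (h : R -> R) : Prop :=
  measurable_fun setT (fun w => \int[m w]_(t in `]0%R, N%:R]) (Num.max 0 (h t))%:E)%E /\
  (\int[P]_w expeR (- \int[m w]_(t in `]0%R, N%:R]) (Num.max 0 (h t))%:E) =
   expeR (- \int[mu]_(t in `]0%R, N%:R]) ((Num.max 0 (h t)) `^ alpha)%:E))%E.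

Lemma laplace_at_grid_step (N n : nat) (h : R -> R) :
  measurable_fun setT h -> laplace_at N (grid_step h n.+1%:R^-1).
Proof.
move=> mh; set delta : R := n.+1%:R^-1.
have d0 : 0 < delta by rewrite invr_gt0.
(* the number of cells of width 1 / (n + 1) in ]0, N] *)
pose K := (N * n.+1)%N.
have NK : N%:R = K%:R * delta :> R by rewrite /K natrM mulfK.
pose h1 t := Num.max 0 (h t); pose h2 t := (h1 t) `^ alpha.
have mh1 : measurable_fun setT h1 by apply: measurable_maxr.
have mh2 : measurable_fun setT h2 by exact: (measurableT_comp (measurable_powR _) mh1).
have h10 t : 0 <= h1 t by rewrite le_max lexx.
have h20 t : 0 <= h2 t by rewrite powR_ge0.
pose Y w := \sum_(k < K) h1 (k.+1%:R * delta) *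
  (S (k.+1%:R * delta) w - S (k%:R * delta) w).
have t0 k : 0 <= k%:R * delta by rewrite mulr_ge0// ltW.
have mE w : (\int[m w]_(t in `]0%R, N%:R])
    (Num.max 0 (grid_step h delta t))%:E = (Y w)%:E)%E.
  rewrite NK; have := integral_grid_step (m w) K d0 mh1 h10; rewrite /grid_step => ->.
  rewrite /Y -sumEFin; apply: eq_bigr => k _.
  rewrite EFinM; congr (_ * _)%E; apply: stieltjes_measure_itv => //.
  by rewrite ler_pM2r// ler_nat.
have muE : (\int[mu]_(t in `]0%R, N%:R])
    ((Num.max 0 (grid_step h delta t)) `^ alpha)%:E =
    (\sum_(k < K) h1 (k.+1%:R * delta) `^ alpha * delta)%:E)%E.
  rewrite NK; have := integral_grid_step mu K d0 mh2 h20; rewrite /grid_step => ->.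
  rewrite -sumEFin; apply: eq_bigr => k _.
  rewrite EFinM; congr (_ * _)%E; apply: etrans (lebesgue_measure_itv _) _ => /=.
  by rewrite lte_fin ltr_pM2r// ltr_nat leqnn -EFinB -mulrBl -natrB// subSnn mul1r.
split.
  under eq_fun do rewrite mE.
  apply/measurable_EFinP; apply: measurable_sum => k.
  by apply: measurable_funM => //; exact: measurable_increment.
under eq_integral do rewrite mE.
by rewrite muE/= (laplace_increments K (fun k => h10 (k.+1%:R * delta)) (ltW d0)).
Qed.

Lemma laplace_at_limit (N : nat) (h_ : nat -> R -> R) (h : R -> R) (M : R) :
  (forall n, measurable_fun setT (h_ n)) -> (forall n x, `|h_ n x| <= M) ->
  (forall x, 0 < x -> h_ n x @[n --> \oo] --> h x) -> (forall n, laplace_at N (h_ n)) ->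
  laplace_at N h.
Proof.
move=> mh hM hh lh.
have M0 : 0 <= M by apply: le_trans (hM 0%N 0).
have hpos n x : 0 <= Num.max 0 (h_ n x) <= M.
  by rewrite le_max lexx/= ge_max M0 (le_trans (ler_norm _) (hM n x)).
have cvgpos x : 0 < x -> Num.max 0 (h_ n x) @[n --> \oo] --> Num.max 0 (h x).
  move=> x0; rewrite maxr_absE; under eq_fun do rewrite maxr_absE.
  apply: cvgM; last exact: cvg_cst; apply: cvgD.
    by apply: cvgD; [exact: cvg_cst|exact: hh].
  by apply: cvg_norm; apply: (@cvgB _ R); [exact: cvg_cst|exact: hh].
have mpos n : measurable_fun setT (fun t => Num.max 0 (h_ n t)) by exact: measurable_maxr.
apply: (@laplace_limit _ _ _ P
  (fun n w => \int[m w]_(t in `]0%R, N%:R]) (Num.max 0 (h_ n t))%:E)%E _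
  (fun n => \int[mu]_(t in `]0%R, N%:R]) ((Num.max 0 (h_ n t)) `^ alpha)%:E)%E).
- by move=> n; exact: (lh n).1.
- move=> n w; apply: integral_ge0 => t _; rewrite lee_fin.
  by have /andP[] := hpos n t.
- move=> w; apply: (@bounded_convergence _ _ _ _ _ _ _ M) => //.
  + by rewrite [X in (X < _)%E](stieltjes_measure_itv w (lexx 0) (ler0n R N)) ltry.
  + by move=> n; apply: measurable_funTS; apply/measurable_EFinP; exact: mpos.
  + by move=> n t _; rewrite !lee_fin.
  + move=> t /=; rewrite in_itv/= => /andP[t0 _].
    by apply: cvg_EFin; [exact: nearW|exact: cvgpos].
- by move=> n; apply: integral_ge0 => t _; rewrite lee_fin powR_ge0.
- apply: (@bounded_convergence _ _ _ _ _ _ _ (M `^ alpha)) => //.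
  + exact: powR_ge0.
  + rewrite [X in (X < _)%E](lebesgue_measure_itv `]0, N%:R])/=.
    by case: ifP; rewrite ?ltry// -EFinB ltry.
  + move=> n; apply: measurable_funTS; apply/measurable_EFinP.
    exact: (measurableT_comp (measurable_powR _) (mpos n)).
  + move=> n t _; have /andP[p0 pM] := hpos n t; rewrite !lee_fin powR_ge0/=.
    by apply: ge0_ler_powR; rewrite ?nnegrE// ltW.
  + move=> t /=; rewrite in_itv/= => /andP[t0 _].
    apply: cvg_EFin; first exact: nearW.
    apply: cvg_powR_ge0 => //; last exact: cvgpos.
    by move=> n; have /andP[] := hpos n t.
- by move=> n; exact: (lh n).2.
Qed.

Lemma laplace_at_continuous (N : nat) (h : R -> R) (M : R) :
  continuous h -> (forall x, `|h x| <= M) -> laplace_at N h.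
Proof.
move=> ch hM; have mh : measurable_fun setT h by exact: continuous_measurable_fun.
apply: (@laplace_at_limit N (fun n => grid_step h n.+1%:R^-1) h M).
- by move=> n; exact: measurable_grid_step.
- by move=> n x; exact: hM.
- move=> x _; apply: (@cvg_grid_step _ h (fun n => n.+1%:R^-1) x (ch x)) => [n|].
    by rewrite invr_gt0.
  exact: (@cvg_harmonic R).
- by move=> n; exact: laplace_at_grid_step.
Qed.

Lemma laplace_at_bounded (N : nat) (h : R -> R) (M : R) :
  measurable_fun setT h -> (forall x, `|h x| <= M) -> laplace_at N h.
Proof.
move=> mh hM; elim: (bounded_measurable_baire mh hM) => [g K cg gK|g_ g K bg ih gK gg].
  exact: laplace_at_continuous cg gK.
apply: (@laplace_at_limit N g_ g K) => // n; exact: baire_measurable.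
Qed.

(** Truncation of f at height n on ]0, n], and n tends to +oo: both integrals increase
    to their possibly infinite limits. *)
Lemma laplace_functional (f : R -> R) :
  measurable_fun (`]0, +oo[ : set R) f -> (forall t, 0 < t -> 0 <= f t) ->
  measurable_fun setT (integral_dS hS f) /\
  (\int[P]_w expeR (- integral_dS hS f w) =
   expeR (- \int[mu]_(t in `]0%R, +oo[) (f t `^ alpha)%:E))%E.
Proof.
move=> mf f0.
pose g (t : R) : R := (f \_ `]0, +oo[) t.
have gE t : 0 < t -> g t = f t.
  by move=> t0; rewrite /g patchE mem_set//= in_itv/= t0.
have g0 t : 0 <= g t.
  rewrite /g patchE; case: ifP => //; rewrite inE/= in_itv/= andbT => t0; exact: f0.
have mg : measurable_fun setT g.
  exact/(measurable_restrictT f (measurable_itv _)).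
pose h (n : nat) (t : R) : R := Num.min (g t) n%:R.
have h0 n t : 0 <= h n t by rewrite le_min g0/=.
have mh n : measurable_fun setT (h n) by apply: measurable_minr.
have hn n : laplace_at n (h n).
  apply: (@laplace_at_bounded _ _ n%:R) => // t.
  by rewrite ger0_norm// ge_min lexx orbT.
have maxh n t : Num.max 0 (h n t) = h n t by exact/max_r.
have ndh t : {homo h^~ t : m n / (m <= n)%N >-> m <= n}.
  by move=> i j ij; rewrite /h le_min2// ler_nat.
have hg t : 0 < t -> \forall n \near \oo, h n t = f t.
  move=> t0; near=> n; rewrite /h gE//; apply/min_l.
  near: n; exact: nbhs_infty_ger.
apply: (@laplace_limit _ _ _ P
  (fun n w => \int[m w]_(t in `]0%R, n%:R]) (Num.max 0 (h n t))%:E)%E _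
  (fun n => \int[mu]_(t in `]0%R, n%:R]) ((Num.max 0 (h n t)) `^ alpha)%:E)%E).
- by move=> n; exact: (hn n).1.
- by move=> n w; apply: integral_ge0 => t _; rewrite maxh lee_fin.
- move=> w; apply: cvg_integral_truncation.
  + by move=> n; exact: measurable_maxr.
  + by move=> n t; rewrite maxh.
  + by move=> t i j ij; rewrite !maxh; exact: ndh.
  + by move=> t t0; near do rewrite maxh; exact: hg.
- by move=> n; apply: integral_ge0 => t _; rewrite lee_fin powR_ge0.
- apply: (@cvg_integral_truncation _ mu (fun n t => Num.max 0 (h n t) `^ alpha)).
  + move=> n; apply: (measurableT_comp (measurable_powR _)).
    exact: measurable_maxr.
  + by move=> n t; exact: powR_ge0.
  + move=> t i j ij; rewrite !maxh; apply: ge0_ler_powR; rewrite ?nnegrE ?h0//.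
      exact: ltW.
    exact: ndh.
  + move=> t t0; have := hg t t0; apply: filterS => n nt.
    by rewrite maxh nt.
- by move=> n; exact: (hn n).2.
Unshelve. all: by end_near. Qed.

End laplace_functional.

(** * Moments of the integral *)

Lemma integral_powR_gt0 (R : realType) (alpha : R) (f : R -> R) :
  measurable_fun (`]0, +oo[ : set R) f -> (forall t : R, 0 < t -> 0 <= f t) ->
  (0 < @lebesgue_measure R (`]0%R, +oo[ `&` [set t | (0 < f t)%R]))%E ->
  (0 < \int[@lebesgue_measure R]_(t in `]0%R, +oo[) (f t `^ alpha)%:E)%E.
Proof.
move=> mf f0; apply: contraTT; rewrite -!leNgt => int0.
pose D : set R := `]0, +oo[%classic.
have mD : measurable D by exact: measurable_itv.
have mfa : measurable_fun D (fun t => (f t `^ alpha)%:E).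
  by apply/measurable_EFinP; exact: (measurableT_comp (measurable_powR _) mf).
have absint0 : (\int[@lebesgue_measure R]_(t in D) `|(f t `^ alpha)%:E| = 0)%E.
  transitivity (\int[@lebesgue_measure R]_(t in D) (f t `^ alpha)%:E)%E.
    by apply: eq_integral => t _; rewrite gee0_abs// lee_fin powR_ge0.
  apply/eqP; rewrite eq_le int0 integral_ge0// => t _.
  by rewrite lee_fin powR_ge0.
have [N [mN N0 sub]] := (ae_eq_integral_abs (@lebesgue_measure R) mD mfa).1 absint0.
rewrite -N0; apply: le_measure; rewrite ?inE//.
  rewrite (_ : _ `&` _ = D `&` f @^-1` `]0, +oo[%classic); first exact: mf.
  by apply/seteqP; split => t; rewrite /D/= !in_itv/= !andbT.
move=> t [Dt ft]; apply: sub => /= /(_ Dt) /eqP.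
by rewrite eqe gt_eqF//; exact: powR_gt0.
Qed.

Theorem proposition3p1 (R : realType) (d : measure_display)
    (T : measurableType d) (P : probability T R)
    (alpha : R) (alpha_gt0 : 0 < alpha) (alpha_lt1 : alpha < 1)
    (S : R -> T -> R) (hS : stable_subordinator P alpha S)
    (f : R -> R) (mf : measurable_fun (`]0, +oo[ : set R) f)
    (f_ge0 : forall t : R, 0 < t -> 0 <= f t)
    (f_pos : (0 < @lebesgue_measure R (`]0%R, +oo[ `&` [set t | (0 < f t)%R]))%E)
    (p : R) :
  (\int[P]_w epow (integral_dS hS f w) p =
   if (p < alpha)%R then
     (Gamma (1 - p / alpha) / Gamma (1 - p))%:E *
     epow (\int[@lebesgue_measure R]_(t in `]0%R, +oo[) ((f t) `^ alpha)%:E)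
       (p / alpha)
   else +oo)%E.
Proof.
have [mX _] := laplace_functional alpha_gt0 hS mf f_ge0.
pose C := (\int[@lebesgue_measure R]_(t in `]0%R, +oo[) ((f t) `^ alpha)%:E)%E.
have X0 w : (0 <= integral_dS hS f w)%E.
  apply: integral_ge0 => t /=; rewrite in_itv/= andbT => t0.
  by rewrite lee_fin f_ge0.
have C0 : (0 <= C)%E by apply: integral_ge0 => t _; rewrite lee_fin powR_ge0.
have laplaceX r : 0 < r -> (\int[P]_w expeR (- (integral_dS hS f w * r%:E)) =
    expeR (- (C * (r `^ alpha)%:E)))%E.
  move=> r0.
  have mrf : measurable_fun (`]0, +oo[ : set R) (fun t => r * f t) by exact: measurable_funM.
  have rf0 t : 0 < t -> 0 <= r * f t by move=> t0; rewrite mulr_ge0 ?f_ge0// ltW.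
  (* r X is the integral of r f, and (r f)^alpha = r^alpha f^alpha *)
  have [_ laplace_rf] := laplace_functional alpha_gt0 hS mrf rf0.
  have CE : (\int[@lebesgue_measure R]_(t in `]0%R, +oo[) ((r * f t) `^ alpha)%:E =
      C * (r `^ alpha)%:E)%E.
    rewrite muleC -ge0_integralZl_EFin ?powR_ge0//; last 2 first.
    - by move=> t _; rewrite lee_fin powR_ge0.
    - by apply/measurable_EFinP; exact: (measurableT_comp (measurable_powR _) mf).
    apply: eq_integral => t; rewrite inE/= in_itv/= andbT => t0.
    by rewrite powRM ?f_ge0// ltW.
  rewrite -CE -laplace_rf; apply: eq_integral => w _; congr (expeR (- _))%E.
  apply/esym; rewrite /integral_dS /stieltjes_integral.
  under eq_integral do rewrite EFinM.
  rewrite ge0_integralZl_EFin//; first by rewrite muleC.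
  - by move=> t /=; rewrite in_itv/= andbT => t0; rewrite lee_fin f_ge0.
  - exact/measurable_EFinP.
  - exact: ltW.
case: ifPn => [palpha|]; last first.
  rewrite -leNgt => alphap.
  apply: (moment_infty alpha_gt0 alpha_lt1 mX X0 C0 laplaceX alphap).
  exact: integral_powR_gt0.
have [p0|p0|->] := ltgtP p 0.
- exact: (moment_neg alpha_gt0 mX X0 C0 laplaceX p0).
- exact: (moment_pos alpha_gt0 alpha_lt1 mX X0 C0 laplaceX p0 palpha).
rewrite mul0r subr0 divff; last by rewrite gt_eqF// -lte_fin GammaE// egamma_gt0.
rewrite mul1e /epow ltxx poweRe0.
under eq_integral do rewrite poweRe0.
by rewrite integral_cst// mul1e; exact: probability_setT.
Qed.
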